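(* Let $G=(V,E)$ be a finite undirected graph with real edge weights $\{w_e\}_{e\in E}$, and let $\mathcal C$ be a collection of odd-length cycles of $G$ that are pairwise edge-disjoint. Consider the linear program $$\text{C-LP}:\quad \max \sum_{e\in E} w_e x_e \ \text{ s.t. } \sum_{e\in\delta(i)} x_e\le 1\ \ \forall i\in V,\quad \sum_{e\in E(C)} x_e\le \tfrac{|C|-1}{2}\ \ \forall C\in\mathcal C,\quad x_e\in[0,1]\ \ \forall e\in E.$$ Suppose C-LP has a unique optimal solution and this solution is integral. Run max-product belief propagation on the graphical model on $y\in\{0,1\}^{E'}$ defined in the context below. Then the BP estimate $y^{\mathrm{BP}}(t)$ converges (i.e. is equal for all sufficiently large $t$) to the MAP assignment $y^*$ of that graphical model. Moreover, the maximum weight matching $x^*\in\{0,1\}^E$ of $G$ is obtained from $y^*$ by $$x^*_e=\begin{cases}\frac12\sum_{j\in V(C)}(-1)^{d_C(j,e)}\,y^*_{(i_C,j)} & \text{if } e\in E(C) \text{ for some } C\in\mathcal C,\\ y^*_e & \text{otherwise.}\end{cases}$$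
   Context: Notation: $\delta(i)$ is the set of edges incident to vertex $i$ (in whichever graph is under discussion). For a cycle $C=(j_1,\dots,j_k)$, $V(C)$ is its vertex set, $|C|=k$ its length, and $E(C)$ its edge set; for a vertex $j\in V(C)$ and an edge $e\in E(C)$, $d_C(j,e)$ is the graph distance in the cycle $C$ between $j$ and the edge $e$ (distance from $j$ to the nearer endpoint of $e$; e.g. if $e=(j_2,j_3)$ then $d_C(j_1,e)=1$ and $d_C(j_2,e)=0$). A matching is a set of edges with no common vertices; a maximum weight matching maximizes the total edge weight. Transformed graph: $G'=(V',E')$ with $V'=V\cup\{i_C: C\in\mathcal C\}$ (one new vertex per cycle) and $E'=\big(E\setminus\bigcup_{C\in\mathcal C}E(C)\big)\cup\{(i_C,j): j\in V(C),\,C\in\mathcal C\}$. Weights: $w'_{(i_C,j)}=\frac12\sum_{e'\in E(C)}(-1)^{d_C(j,e')}w_{e'}$ for the new edges, and $w'_e=w_e$ for all other edges of $E'$. Graphical model: for $y=[y_e]\in\{0,1\}^{E'}$, $\Pr[Y=y]\propto\prod_{e\in E'}e^{w'_e y_e}\prod_{i\in V}\psi_i(y)\prod_{C\in\mathcal C}\psi_C(y)$, where $\psi_i(y)=1$ if $\sum_{e\in\delta(i)}y_e\le1$ (with $\delta(i)$ taken in $G'$) and $0$ otherwise; and $\psi_C(y)=0$ if $\sum_{e\in\delta(i_C)}y_e>|C|-1$, or if $\sum_{j\in V(C)}(-1)^{d_C(j,e)}y_{(i_C,j)}\notin\{0,2\}$ for some $e\in E(C)$; and $\psi_C(y)=1$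 otherwise. The MAP assignment $y^*$ is the maximizer of this distribution. Max-product BP: the factors are the $\psi_i$ ($i\in V$, involving variables $y_e$, $e\in\delta(i)$) and the $\psi_C$ ($C\in\mathcal C$, involving $y_e$, $e\in\delta(i_C)$); the variable function of $y_e$ is $e^{w'_e y_e}$. Messages between each variable $e$ and each factor $\alpha$ containing it are initialized to $1$ and updated by $m^{t+1}_{\alpha\to e}(z)=\max_{y':y'_e=z}\psi_\alpha(y')\prod_{f\in\alpha\setminus e}m^t_{f\to\alpha}(y'_f)$ and $m^{t+1}_{e\to\alpha}(z)=e^{w'_e z}\prod_{\alpha'\ni e,\alpha'\ne\alpha}m^t_{\alpha'\to e}(z)$. The belief is $n^t_e(z)=e^{w'_e z}\prod_{\alpha\ni e}m^t_{\alpha\to e}(z)$, and the BP estimate is $y^{\mathrm{BP}}_e(t)=1$ if $n^t_e(1)>n^t_e(0)$, $0$ if $n^t_e(1)<n^t_e(0)$, and ''?'' if equal. *)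

(* Defs.v *)
From HB Require Import structures.
From mathcomp Require Import all_boot all_order all_algebra.
From mathcomp Require Import reals sequences exp.
Set Implicit Arguments. Unset Strict Implicit. Unset Printing Implicit Defensive.
Import Order.TTheory GRing.Theory Num.Theory.
Local Open Scope ring_scope.

Section Cycles.
Variable V : finType.

Definition cedges (c : seq V) : seq {set V} :=
  [seq [set p.1; p.2] | p <- zip c (rot 1 c)].
Definition ECset (c : seq V) : {set {set V}} := [set e | e \in cedges c].

Definition cycdist (c : seq V) (j a : V) : nat :=
  let p := index j c in let q := index a c in
  let d := ((p - q) + (q - p))%N in minn d (size c - d).

Definition dC (c : seq V) (j : V) (e : {set V}) : nat :=
  \big[minn/size c]_(a in e) cycdist c j a.

Definition odd_cycle_of (E : {set {set V}}) (c : seq V) : bool :=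
  [&& (3 <= size c)%N, uniq c, odd (size c) & all (fun e => e \in E) (cedges c)].
End Cycles.

Section Matching.
Variables (R : realType) (V : finType) (E : {set {set V}}) (w : {set V} -> R).

Definition is_matching (M : {set {set V}}) : Prop :=
  M \subset E /\ forall e f, e \in M -> f \in M -> e != f -> [disjoint e & f].

Definition is_max_weight_matching (M : {set {set V}}) : Prop :=
  is_matching M /\ forall M', is_matching M' -> \sum_(e in M') w e <= \sum_(e in M) w e.

Variables (K : finType) (cyc : K -> seq V).

Definition CLP_feasible (x : {set V} -> R) : Prop :=
  [/\ forall i : V, \sum_(e in E | i \in e) x e <= 1,
      forall C : K, \sum_(e in ECset (cyc C)) x e <= ((size (cyc C))%:R - 1) / 2
    & forall e, e \in E -> 0 <= x e <= 1].

Definition CLP_obj (x : {set V} -> R) : R := \sum_(e in E) w e * x e.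

Definition CLP_optimal (x : {set V} -> R) : Prop :=
  CLP_feasible x /\ forall x', CLP_feasible x' -> CLP_obj x' <= CLP_obj x.

Definition CLP_unique_integral_opt : Prop :=
  exists x0, [/\ CLP_optimal x0,
    (forall x, CLP_optimal x -> forall e, e \in E -> x e = x0 e)
    & forall e, e \in E -> x0 e = 0 \/ x0 e = 1].
End Matching.

Section Model.
Variables (R : realType) (V K : finType) (E : {set {set V}}) (cyc : K -> seq V)
          (w : {set V} -> R).

(* universe: old edges  inl e,  new edges  inr (C, j) = (i_C, j) *)
Definition U : finType := ({set V} + (K * V))%type.

Definition in_cycle_edge (e : {set V}) : bool := [exists C : K, e \in ECset (cyc C)].

Definition inEp (u : U) : bool :=
  match u with
  | inl e => (e \in E) && ~~ in_cycle_edge e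
  | inr (C, j) => j \in cyc C
  end.

Definition Ep : finType := {u : U | inEp u}.

Definition yext (y : {ffun Ep -> bool}) (u : U) : bool :=
  if insub u is Some u' then y u' else false.

Definition wp (u : Ep) : R :=
  match val u with
  | inl e => w e
  | inr (C, j) => 2^-1 * \sum_(e' in ECset (cyc C)) (-1) ^+ (dC (cyc C) j e') * w e'
  end.

Definition Fac : finType := (V + K)%type.

(* variable u belongs to factor alpha: u in delta(i) in G', resp. u in delta(i_C) *)
Definition memF (alpha : Fac) (u : Ep) : bool :=
  match alpha, val u with
  | inl i, inl e => i \in e
  | inl i, inr (_, j) => j == i
  | inr C, inl _ => false
  | inr C, inr (C', _) => C' == C
  end.

Definition psi (alpha : Fac) (y : {ffun Ep -> bool}) : R :=
  match alpha with
  | inl i => if (\sum_(u : Ep | memF (inl i) u) (y u : nat) <= 1)%N then 1 else 0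
  | inr C =>
      if (size (cyc C) - 1 < \sum_(u : Ep | memF (inr C) u) (y u : nat))%N
         || [exists e in ECset (cyc C),
               let s : R := \sum_(j <- cyc C) (-1) ^+ (dC (cyc C) j e) * (yext y (inr (C, j)) : nat)%:R
               in (s != 0) && (s != 2)]
      then 0 else 1
  end.

Definition Pweight (y : {ffun Ep -> bool}) : R :=
  (\prod_(u : Ep) expR (wp u * (y u : nat)%:R)) * \prod_(alpha : Fac) psi alpha y.

Definition is_MAP (y : {ffun Ep -> bool}) : Prop :=
  forall y', Pweight y' <= Pweight y.

Record msgs := Msgs { f2v : Fac -> Ep -> bool -> R ; v2f : Ep -> Fac -> bool -> R }.

Definition msgs0 : msgs := Msgs (fun _ _ _ => 1) (fun _ _ _ => 1).

Definition bp_step (m : msgs) : msgs :=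
  Msgs
    (fun alpha e z =>
       \big[Num.max/0]_(y : {ffun Ep -> bool} | y e == z)
          (psi alpha y * \prod_(f : Ep | memF alpha f && (f != e)) v2f m f alpha (y f)))
    (fun e alpha z =>
       expR (wp e * (z : nat)%:R) *
       \prod_(alpha' : Fac | memF alpha' e && (alpha' != alpha)) f2v m alpha' e z).

Definition msgs_at (t : nat) : msgs := iter t bp_step msgs0.

Definition belief (t : nat) (e : Ep) (z : bool) : R :=
  expR (wp e * (z : nat)%:R) * \prod_(alpha : Fac | memF alpha e) f2v (msgs_at t) alpha e z.

Definition yBP (t : nat) (e : Ep) : option bool :=
  if belief t e false < belief t e true then Some true
  else if belief t e true < belief t e false then Some false
  else None.

Definition xrec (y : {ffun Ep -> bool}) (e : {set V}) : R :=
  match [pick C : K | e \in ECset (cyc C)] with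
  | Some C => 2^-1 * \sum_(j <- cyc C) (-1) ^+ (dC (cyc C) j e) * (yext y (inr (C, j)) : nat)%:R
  | None => (yext y (inl e) : nat)%:R
  end.
End Model.

(* Main.v *)
Require Import Defs.
From HB Require Import structures.
From mathcomp Require Import all_boot all_order all_algebra.
From mathcomp Require Import reals sequences exp.
From mathcomp Require Import zify ring lra.
Import Order.TTheory GRing.Theory Num.Theory.
Local Open Scope ring_scope.
Set Implicit Arguments. Unset Strict Implicit. Unset Printing Implicit Defensive.

(** Write the model over [G'] and let [y] be its MAP assignment. Every variable
    belongs to exactly two factors, so the recursion for the messages can be followed
    along walks. Let [y] and [v] be two assignments accepted by a factor which differ
    at a variable [u]. Then flipping [u], possibly together with one other variable
    [g] where they differ, keeps both assignments acceptable: for a vertex factor [g]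
    is the other selected edge, for a cycle factor it is the other end of the
    alternating path through [u] in the symmetric difference of two matchings of the
    cycle. Hence the ratio between the messages for the wrong and the right value of a
    variable is at most the exponential of the signed weight of a walk of admissible
    flips, and this walk either stops at a factor that accepts a single flip or lasts
    as long as the messages have been running.

    A closed walk, or a pair of stopped walks glued at a variable, is a nonzero
    direction in which one can move from [y] inside the polytope spanned by locally
    acceptable assignments. The linear map [xrec] sends that polytope to C-LP and
    preserves the objective, so by uniqueness of the optimum such a direction has
    negative weight. Closed walks being negative, long walks have arbitrarily negative
    weight, and the wrong value eventually loses everywhere. *)

(** * Odd cycles *)

Lemma sumr_perm_image (T : eqType) (R : nmodType) (s : seq T) (h : T -> T) (F : T -> R) :
  perm_eq [seq h i | i <- s] s -> \sum_(i <- s) F (h i) = \sum_(i <- s) F i.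
Proof. by move=> hs; rewrite -(big_map h xpredT F) (perm_big _ hs). Qed.

(** The minimum in [dC] starts from [size c], which is not neutral for [minn], so reordering it
    rests on a semigroup law. *)
HB.instance Definition _ := SemiGroup.isComLaw.Build nat minn minnA minnC.

Lemma addr_signs (R : pzRingType) (d b1 b2 : bool) :
  (if d then ~~ b1 && ~~ b2 else b1 != b2) ->
  (-1) ^+ b1 + (-1) ^+ b2 = d%:R *+ 2 :> R.
Proof.
by case: d b1 b2 => [] [] [] //= _; rewrite ?expr1 ?expr0 ?addNr ?subrr ?mul0rn ?mulr2n.
Qed.

Section Cycle.
Variables (V : finType) (c : seq V).
Hypotheses (Uc : uniq c) (c3 : (3 <= size c)%N).

Lemma index_next j : j \in c ->
  index (next c j) c = if (index j c).+1 == size c then 0%N else (index j c).+1.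
Proof.
move=> jc; rewrite next_nth jc; move: jc Uc c3; case: c => // y p jc Up _.
set k := index j _.
have kp : (k < (size p).+1)%N by rewrite /k index_mem.
case: ifP => [/eqP [->]|nk]; first by rewrite nth_default //= eqxx.
have kp' : (k < size p)%N by rewrite /= eqSS in nk; lia.
by rewrite -[nth y p k]/(nth y (y :: p) k.+1) index_uniq.
Qed.

Lemma map_next : [seq next c j | j <- c] = rot 1 c.
Proof.
case Ec: c Uc c3 => [|y p] // Uy _; rewrite rot1_cons.
apply: (@eq_from_nth _ y); first by rewrite size_map size_rcons.
move=> i; rewrite size_map => ip.
rewrite (nth_map y) // next_nth mem_nth // index_uniq // nth_rcons.
move: ip; rewrite /= ltnS leq_eqVlt; case: ltnP => // pi; rewrite orbF => /eqP ->.
by rewrite eqxx nth_default.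
Qed.

Lemma perm_next : perm_eq [seq next c j | j <- c] c.
Proof. by rewrite map_next perm_rot. Qed.

Lemma perm_prev : perm_eq [seq prev c j | j <- c] c.
Proof.
apply: uniq_perm => //; first by rewrite (map_inj_uniq (can_inj (next_prev Uc))).
move=> x; apply/mapP/idP => [[y yc ->]|xc]; first by rewrite mem_prev.
by exists (next c x); rewrite ?mem_next ?prev_next.
Qed.

Definition cedge j : {set V} := [set j; next c j].

Lemma cedgesE : cedges c = [seq cedge j | j <- c].
Proof.
rewrite /cedges -map_next -[X in zip X](map_id c) zip_map -map_comp.
by apply: eq_map.
Qed.

Lemma next_neq j : j \in c -> next c j != j.
Proof.
move=> jc; apply/eqP => /(congr1 (index^~ c)); rewrite index_next //.
by case: eqP; move: c3; lia.
Qed.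

Lemma next2_neq j : j \in c -> next c (next c j) != j.
Proof.
move=> jc; apply/eqP => /(congr1 (index^~ c)).
rewrite index_next ?mem_next // index_next //.
have := index_mem j c; rewrite jc.
by do 2 case: ifP => /eqP; move: c3; lia.
Qed.

(** Two names for one edge would be successors of each other, which a cycle of length at least 3
    excludes. *)
Lemma cedge_inj : {in c &, injective cedge}.
Proof.
move=> i j ic jc /setP e.
have := e i; rewrite !inE eqxx /= => /esym/orP[/eqP //|/eqP ij].
have := e j; rewrite !inE eqxx /= => /orP[/eqP //|/eqP ji].
by have := next2_neq jc; rewrite -ij -ji eqxx.
Qed.

Lemma sum_ECset (R : nmodType) (F : {set V} -> R) :
  \sum_(e in ECset c) F e = \sum_(j <- c) F (cedge j).
Proof.
have U : uniq (cedges c) by rewrite cedgesE map_inj_in_uniq //; apply: cedge_inj.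
rewrite (eq_bigl (mem (cedges c))) => [|e]; last by rewrite inE.
by rewrite -big_uniq // cedgesE big_map.
Qed.

Lemma cedge_ECset j : j \in c -> cedge j \in ECset c.
Proof. by move=> jc; rewrite inE cedgesE map_f. Qed.

Lemma ECsetP e : reflect (exists2 j, j \in c & e = cedge j) (e \in ECset c).
Proof. by rewrite inE cedgesE; apply: mapP. Qed.

Lemma mem_cedge i j : (i \in cedge j) = (i == j) || (prev c i == j).
Proof. by rewrite !inE (can2_eq (next_prev Uc) (prev_next Uc)). Qed.

Lemma prev_neq j : j \in c -> prev c j != j.
Proof.
by move=> jc; rewrite (can2_eq (next_prev Uc) (prev_next Uc)) eq_sym next_neq.
Qed.

Lemma sum_ECset_at (R : nmodType) (F : {set V} -> R) i : i \in c ->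
  \sum_(e in ECset c | i \in e) F e = F (cedge i) + F (cedge (prev c i)).
Proof.
move=> ic; rewrite big_mkcondr sum_ECset -big_mkcond /=.
have pc : prev c i \in c by rewrite mem_prev.
rewrite big_mkcond (bigD1_seq i) //= mem_cedge eqxx /=; congr (_ + _).
rewrite big_mkcond (bigD1_seq (prev c i)) //= prev_neq // mem_cedge eqxx orbT /=.
rewrite big1 ?addr0 // => j; rewrite mem_cedge eq_sym.
by case: (eqVneq j i) => // _ /negPf ->.
Qed.

Hypothesis oc : odd (size c).

(* Along an odd cycle the distance from [j] to an edge at offset [r] is
   [minn r (size c - 1 - r)], which has the parity of [r]. *)
Lemma odd_dC i j : i \in c -> j \in c ->
  odd (dC c j (cedge i)) = odd (index i c + index j c) (+) (index i c < index j c)%N.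
Proof.
move=> ic jc; rewrite /dC /cedge.
have nc := next_neq ic; rewrite -big_enum /=.
rewrite (perm_big [:: i; next c i]) /=; last first.
  apply: uniq_perm; rewrite ?enum_uniq //= ?inE 1?eq_sym ?nc //.
  by move=> a; rewrite mem_enum !inE.
rewrite big_cons big_cons big_nil /cycdist index_next //.
have := index_mem i c; have := index_mem j c; rewrite ic jc; move: c3 oc.
move: (index i c) (index j c) (size c) => p q n n3 on qn pn.
by case: eqP => e; lia.
Qed.

Variable R : realFieldType.

Definition csgn (j i : V) : R := (-1) ^+ dC c j (cedge i).

Lemma csgnE i j : i \in c -> j \in c ->
  csgn j i = (-1) ^+ (odd (index i c + index j c) (+) (index i c < index j c)%N).
Proof. by move=> ic jc; rewrite /csgn -signr_odd odd_dC. Qed.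

Lemma index_prev j : j \in c ->
  index j c = if (index (prev c j) c).+1 == size c then 0%N else (index (prev c j) c).+1.
Proof. by move=> jc; rewrite -index_next ?mem_prev // next_prev. Qed.

(** Going round the odd cycle, the parity of the distance to [j] changes from each edge to the next,
    except at [j] itself, whose two edges are both at distance 0. *)
Lemma csgn_vertex i j : i \in c -> j \in c ->
  csgn j i + csgn j (prev c i) = (i == j)%:R *+ 2.
Proof.
move=> ic jc; rewrite !csgnE ?mem_prev //.
have := index_prev ic; have := index_mem (prev c i) c; have := index_mem j c.
rewrite mem_prev ic jc.
have -> : (i == j) = (index i c == index j c).
  by apply/eqP/eqP => [->//|e]; rewrite -(nth_index i ic) e nth_index.
move: oc; move: (index i c) (index j c) (size c) (index (prev c i) c) => p q n p' on qn pn e.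
suff : (if p == q then ~~ (odd (p + q) (+) (p < q)%N) && ~~ (odd (p' + q) (+) (p' < q)%N)
        else (odd (p + q) (+) (p < q)%N) != (odd (p' + q) (+) (p' < q)%N)).
  exact: addr_signs.
by move: e; case: (eqVneq p'.+1 n) => e ->; case: eqVneq => e'; lia.
Qed.

(** The same alternation with the edge fixed and the vertex moving. *)
Lemma csgn_edge i j : i \in c -> j \in c ->
  csgn i j + csgn (next c i) j = (i == j)%:R *+ 2.
Proof.
move=> ic jc; rewrite !csgnE ?mem_next //.
have := index_next ic; have := index_mem i c; have := index_mem j c.
rewrite ic jc.
have -> : (i == j) = (index i c == index j c).
  by apply/eqP/eqP => [->//|e]; rewrite -(nth_index i ic) e nth_index.
move: oc; move: (index j c) (index i c) (size c) (index (next c i) c) => p q n p' on qn pn e.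
suff : (if q == p then ~~ (odd (p + q) (+) (p < q)%N) && ~~ (odd (p + p') (+) (p < p')%N)
        else (odd (p + q) (+) (p < q)%N) != (odd (p + p') (+) (p < p')%N)).
  exact: addr_signs.
by move: e; case: (eqVneq q.+1 n) => e ->; case: eqVneq => e'; lia.
Qed.

(** Inverse of the map from edge values [x] to vertex sums [x i + x (prev c i)], invertible because
    the cycle is odd; [cval_vertex] and [cval_edge] are the two compositions. *)
Definition cval (z : V -> R) i := 2^-1 * \sum_(j <- c) csgn j i * z j.

Lemma cval_vertex z i : i \in c -> cval z i + cval z (prev c i) = z i.
Proof.
move=> ic; rewrite /cval -mulrDr -big_split /=.
rewrite (bigD1_seq i) //= -mulrDl csgn_vertex // eqxx big_seq_cond big1.
  by rewrite addr0 -mulr_natl mulr1 mulrA mulVf ?mul1r // pnatr_eq0.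
by move=> j /andP[jc ij]; rewrite -mulrDl csgn_vertex // eq_sym (negPf ij) mul0rn mul0r.
Qed.

Lemma cval_edge (x z : V -> R) i : i \in c ->
  (forall j, j \in c -> z j = x j + x (prev c j)) -> cval z i = x i.
Proof.
move=> ic zx; rewrite /cval; under eq_big_seq => j jc do rewrite zx // mulrDr.
rewrite big_split /= -(sumr_perm_image (fun j => csgn j i * x (prev c j)) perm_next).
rewrite -big_split /= (bigD1_seq i) //= prev_next // -mulrDl csgn_edge // eqxx.
rewrite big_seq_cond big1.
  by rewrite addr0 -mulr_natl mulr1 mulrA mulVf ?mul1r // pnatr_eq0.
move=> j /andP[jc ij].
by rewrite prev_next // -mulrDl csgn_edge // (negPf ij) mul0rn mul0r.
Qed.

Lemma sum_cval z : \sum_(i <- c) cval z i = 2^-1 * \sum_(j <- c) z j.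
Proof.
rewrite -[in RHS](eq_big_seq _ (@cval_vertex z)) big_split /=.
rewrite (sumr_perm_image (cval z) perm_prev); lra.
Qed.

(** Every selected edge is counted at both its ends, so the sum is even, whereas [size c] is odd. *)
Lemma cval_bool_le (z x : V -> bool) :
  (forall j, j \in c -> (z j : nat) = (x j + x (prev c j))%N) ->
  (\sum_(j <- c) z j <= size c - 1)%N.
Proof.
move=> zx.
have ev : (\sum_(j <- c) z j = (\sum_(j <- c) x j).*2)%N.
  rewrite (eq_big_seq _ zx) big_split /= -addnn; congr addn.
  by rewrite -(big_map (prev c) xpredT (fun i => x i : nat)) (perm_big _ perm_prev).
have le : (\sum_(j <- c) z j <= size c)%N.
  by rewrite -sum1_size leq_sum // => j _; case: (z j).
by move: oc le; rewrite ev; lia.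
Qed.

End Cycle.

(* [a] and [b] are matchings of a cycle traversed by [f], given on edges named by an end
   point; [va] and [vb] are the sets of vertices they cover. Swapping [a] and [b] along
   the maximal run from [j] on which they differ affects only the ends of that run. *)
Lemma exchange_run (T : finType) (f g : T -> T) (fg : cancel f g) (gf : cancel g f)
    (D : pred T) (a b va vb : T -> bool) (j : T) :
  (forall i, D i -> D (f i)) -> D j ->
  (forall i, D i -> va i = a i + a (g i) :> nat)%N ->
  (forall i, D i -> vb i = b i + b (g i) :> nat)%N ->
  a j != b j -> a (g j) = b (g j) ->
  exists h (a' b' : T -> bool), [/\ D h, h != j, va h != vb h &
   forall i, D i ->
     (if i \in [:: j; h] then vb i else va i) = a' i + a' (g i) :> nat /\
     (if i \in [:: j; h] then va i else vb i) = b' i + b' (g i) :> nat]%N.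
Proof.
move=> Df Dj Ha Hb abj abg.
(* Iterating [f] from [j] reaches [g j], where [a] and [b] agree. So the run [S] starting at [j]
   ends, and [h] is the first point after it. *)
have exm : exists m, a (iter m f j) == b (iter m f j).
  have : fconnect f j (g j).
    by rewrite (fconnect_sym (can_inj fg)) -{2}[j]gf fconnect1.
  by move/iter_findex => e; exists (findex f j (g j)); rewrite e abg.
case: (ex_minnP exm) => m /eqP abm min_m.
have m_gt0 : (0 < m)%N by case: m abm {min_m} => //= e; rewrite e eqxx in abj.
have DI k : D (iter k f j) by elim: k => //= k; apply: Df.
pose h := iter m f j.
pose S x := [exists k : 'I_m, x == iter k f j].
have Sdiff x : S x -> a x != b x.
  by case/existsP=> k /eqP ->; apply/negP => /min_m; rewrite leqNgt ltn_ord.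
have Sj : S j by apply/existsP; exists (Ordinal m_gt0).
have NSh : ~~ S h by apply/negP => /Sdiff; rewrite abm eqxx.
have NSgj : ~~ S (g j) by apply/negP => /Sdiff; rewrite abg eqxx.
have Sgh : S (g h).
  apply/existsP; case: m m_gt0 @h {S Sdiff Sj NSh NSgj abm min_m} => // m _ /=.
  by exists ord_max; rewrite fg.
have entry i : S i -> ~~ S (g i) -> i = j.
  case/existsP=> -[[|k] km] /eqP -> //= /existsP []; rewrite fg.
  by exists (Ordinal (ltnW km)).
have exit i : ~~ S i -> S (g i) -> i = h.
  move=> NSi /existsP [k /eqP gi]; have ei : i = iter k.+1 f j by rewrite /= -gi gf.
  have: ~~ (k.+1 < m)%N.
    by apply: contra NSi => km; apply/existsP; exists (Ordinal km); rewrite ei.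
  rewrite -leqNgt => mk; rewrite ei /h; congr (iter _ f j).
  by apply/eqP; rewrite eqn_leq mk ltn_ord.
have Dh : D h := DI m.
have hj : h != j by apply: contra NSh => /eqP ->.
have abh : va h != vb h.
  move: (Ha _ Dh) (Hb _ Dh) (Sdiff _ Sgh) abm; rewrite -/h.
  by case: (va h) (vb h) (a h) (b h) (a (g h)) (b (g h)) => [] [] [] [] [] [].
exists h, (fun i => if S i then b i else a i), (fun i => if S i then a i else b i).
split=> // i Di; rewrite !inE.
move: (Ha _ Di) (Hb _ Di).
have [-> /=|ij] := eqVneq i j.
  by rewrite Sj (negPf NSgj) abg /= => -> ->.
have [->|ih] := eqVneq i h.
  by rewrite (negPf NSh) Sgh -/h abm /= => -> ->.
case Si : (S i); case Sgi : (S (g i)) => //=.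
(* Inside the run [a] and [b] differ on both edges at [i]. Each has at most one of them, so both
   cover [i], before and after the swap. *)
- move: (Sdiff _ Si) (Sdiff _ Sgi).
  by case: (va i) (vb i) (a i) (b i) (a (g i)) (b (g i)) => [] [] [] [] [] [].
- by move: ij; rewrite (entry i) ?Sgi ?eqxx.
- by move: ih; rewrite (exit i) ?Si ?eqxx.
Qed.

(** * Walks in weighted digraphs *)

Lemma fin_ub (R : realFieldType) (T : finType) (F : T -> R) :
  exists2 b, 0 <= b & forall x, F x <= b.
Proof.
exists (\sum_x `|F x|) => [|x]; first by rewrite sumr_ge0.
by rewrite (bigD1 x) //= (le_trans (ler_norm _)) // lerDl sumr_ge0.
Qed.

Lemma fin_neg_gap (R : realFieldType) (T : finType) (P : pred T) (F : T -> R) :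
  (forall x, P x -> F x < 0) -> exists2 c, 0 < c & forall x, P x -> F x <= - c.
Proof.
(* [b] bounds every [- (F x)^-1]; adding 1 allows inversion even when [b] is 0. *)
move=> H; have [b b0 bP] := fin_ub (fun x => - (F x)^-1).
have b1 : 0 < b + 1 by lra.
exists (b + 1)^-1 => [|x Px]; first by rewrite invr_gt0.
have Fx := H _ Px; rewrite lerNr -[leRHS]invrK lef_pV2 ?posrE //; last first.
  by rewrite invr_gt0; lra.
by rewrite invrN (le_trans (bP x)) // lerDl ler01.
Qed.

Section WalkWeights.
Variables (R : realFieldType) (S : finType) (e : rel S) (wt : S -> R).

(** Loops are erased starting from the end: if [s] reappears in the reduced tail, the part up to
    there is a simple closed walk, and dropping it does not lower the weight. The starting state is
    not counted, so a closed walk counts each of its states once. *)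
Lemma path_reduce (wt' : S -> R) :
  (forall s p, path e s p -> uniq p -> last s p = s -> \sum_(x <- p) wt' x <= 0) ->
  forall s p, path e s p -> exists q,
    [/\ path e s q, uniq (s :: q), last s q = last s p &
        \sum_(x <- p) wt' x <= \sum_(x <- q) wt' x].
Proof.
move=> cyc s p; elim: p s => [|x p IH] s /=; first by exists [::]; split.
case/andP=> sx /IH [q [pq Uq lq le_pq]].
have [sq|Nsq] := boolP (s \in x :: q); last first.
  exists (x :: q); split=> //=; rewrite ?sx ?pq //; first by rewrite Nsq.
  by rewrite !big_cons lerD2l.
have pxq : path e s (x :: q) by rewrite /= sx.
have lxq : last s (x :: q) = last x p by [].
have sum_le : \sum_(y <- x :: p) wt' y <= \sum_(y <- x :: q) wt' y.
  by rewrite !big_cons lerD2l.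
move: pxq Uq lxq sum_le; case/splitPr: sq => r1 r2.
rewrite -cat_rcons cat_path last_rcons => /andP[pr1 pr2] Ur lr le.
exists r2; split=> //.
- by move: Ur; rewrite -cats1 -catA /= cat_uniq => /and3P[].
- by rewrite -lr last_cat last_rcons.
- move: le; rewrite big_cat /= => le; apply: (le_trans le).
  rewrite gerDr; apply: (cyc s) => //; last by rewrite last_rcons.
  by move: Ur; rewrite cat_uniq => /andP[].
Qed.

(* Raising all weights by a small [c] keeps simple cycles nonpositive, so erasing loops
   bounds the raised weight of any path by that of a path without repetition. *)
Lemma path_weight_ub :
  (forall s p, path e s p -> p != [::] -> last s p = s -> \sum_(x <- p) wt x < 0) ->
  exists B c, [/\ 0 <= B, 0 < c &
    forall s p, path e s p -> \sum_(x <- p) wt x <= B - c * (size p)%:R].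
Proof.
(* Simple closed walks have at most [#|S|] states and thus live in a finite type, so their weights
   have a common gap [c0] below 0. Raising each weight by [c] uses up at most [c0] on such a
   walk. *)
move=> neg; pose T : finType := (S * {bseq #|S| of S})%type.
have [c0 c0_gt0 c0P] : exists2 c, 0 < c & forall x : T,
    [&& path e x.1 x.2, x.2 != [::] :> seq S & last x.1 x.2 == x.1] ->
    \sum_(y <- x.2) wt y <= - c.
  by apply: fin_neg_gap => x /and3P[px nx /eqP lx]; apply: (neg x.1).
have N_size (p : seq S) : uniq p -> (size p <= #|S|)%N.
  by move=> Up; rewrite -(card_uniqP Up) max_card.
pose c := c0 / (#|S|.+1)%:R.
have c_gt0 : 0 < c by rewrite divr_gt0.
have cN : c * (#|S|)%:R <= c0.
  by rewrite /c mulrAC ler_pdivrMr ?ltr0n // ler_wpM2l ?(ltW c0_gt0) // ler_nat.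
have sumc (p : seq S) : \sum_(x <- p) (wt x + c) = \sum_(x <- p) wt x + c * (size p)%:R.
  by rewrite big_split /= big_const_seq count_predT iter_addr_0 mulr_natr.
have [b b0 bP] := fin_ub (fun x => wt x + c).
exists (b * #|S|%:R), c; split=> // [|s p sp]; first by rewrite mulr_ge0.
rewrite lerBrDr -sumc.
have [|q [pq /= /andP[_ Uq] _ le]] := @path_reduce (fun x => wt x + c) _ s p sp.
  move=> s' p' sp' Up' lp'; rewrite sumc; have [->|np'] := eqVneq p' [::].
    by rewrite big_nil mulr0 addr0.
  have := c0P (s', Bseq (N_size _ Up')); rewrite /= sp' np' lp' eqxx => /(_ isT).
  have : c * (size p')%:R <= c * (#|S|)%:R.
    by apply: ler_wpM2l; rewrite ?(ltW c_gt0) // ler_nat N_size.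
  by move: cN; lra.
apply: (le_trans le); have -> : b * #|S|%:R = \sum_(x : S) b.
  by rewrite sumr_const mulr_natr.
rewrite big_uniq //= (bigID (mem q) predT) /= -[leLHS]addr0 lerD ?sumr_ge0 //.
exact: ler_sum.
Qed.
End WalkWeights.

(** * The transformed graph *)

Section Transform.
Variables (R : realType) (V K : finType) (E : {set {set V}}) (cyc : K -> seq V)
          (w : {set V} -> R).
Hypotheses (Hcyc : forall C, odd_cycle_of E (cyc C))
  (Hdisj : forall C D, C != D -> [disjoint ECset (cyc C) & ECset (cyc D)]).

Local Notation Ep := (Ep E cyc).
Local Notation U := (U V K).
Local Notation Fac := (Fac V K).
Local Notation inEp := (inEp E cyc).
Local Notation old e := (~~ in_cycle_edge cyc e).

Lemma cyc3 C : (3 <= size (cyc C))%N. Proof. by case/and4P: (Hcyc C). Qed.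
Lemma cycU C : uniq (cyc C). Proof. by case/and4P: (Hcyc C). Qed.
Lemma cyco C : odd (size (cyc C)). Proof. by case/and4P: (Hcyc C). Qed.
Lemma cycE C e : e \in ECset (cyc C) -> e \in E.
Proof. by case/and4P: (Hcyc C) => _ _ _ /allP H; rewrite inE => /H. Qed.

Lemma cyc_unique e C D : e \in ECset (cyc C) -> (e \in ECset (cyc D)) = (C == D).
Proof.
move=> eC; have [<-//|CD] := eqVneq C D.
by rewrite (disjointFr (Hdisj CD)).
Qed.

Definition memU (alpha : Fac) (u : U) : bool :=
  match alpha, u with
  | inl i, inl e => i \in e
  | inl i, inr (_, j) => j == i
  | inr C, inl _ => false
  | inr C, inr (C', _) => C' == C
  end.

Lemma memFE alpha (u : Ep) : memF alpha u = memU alpha (val u).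
Proof. by case: alpha => ?; rewrite /memF; case: (val u) => // -[]. Qed.

Definition zext (z : Ep -> R) (u : U) : R := oapp z 0 (insub u).

Lemma zext_val z (u : Ep) : zext z (val u) = z u.
Proof. by rewrite /zext valK. Qed.

Lemma yext_val (y : {ffun Ep -> bool}) (u : Ep) : yext y (val u) = y u.
Proof. by rewrite /yext valK. Qed.

Lemma zext_bool (y : {ffun Ep -> bool}) u :
  zext (fun x => (y x : nat)%:R) u = (yext y u : nat)%:R.
Proof. by rewrite /zext /yext; case: insub. Qed.

Lemma sum_Ep (T : nmodType) (P : pred U) (F : U -> T) :
  \sum_(u : Ep | P (val u)) F (val u) = \sum_(u | inEp u && P u) F u.
Proof.
rewrite [RHS](reindex_omap (val : Ep -> U) insub); last first.
  by move=> i /andP[iA Pi]; rewrite insubT.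
by apply: eq_bigl => u; rewrite valK eqxx andbT (valP u).
Qed.

Lemma sum_cycle_factor (T : nmodType) (F : U -> T) C :
  \sum_(u : Ep | memF (inr C) u) F (val u) = \sum_(j <- cyc C) F (inr (C, j)).
Proof.
under eq_bigl => u do rewrite memFE.
rewrite sum_Ep big_sumType /= big_pred0 ?add0r; last by move=> e; rewrite andbF.
rewrite big_uniq ?cycU //=.
transitivity (\sum_(D | D == C) \sum_(j in cyc D) F (inr (D, j))); last by rewrite big_pred1_eq.
rewrite (pair_big_dep (fun D => D == C) (fun D j => j \in cyc D) (fun D j => F (inr (D, j)))) /=.
by apply: eq_big => [[D j]|[D j] _] //=; rewrite andbC.
Qed.

Lemma sum_vertex_factor (T : nmodType) (F : U -> T) i :
  \sum_(u : Ep | memF (inl i) u) F (val u) =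
  \sum_(e in E | old e && (i \in e)) F (inl e) + \sum_(C | i \in cyc C) F (inr (C, i)).
Proof.
under eq_bigl => u do rewrite memFE.
rewrite sum_Ep big_sumType /=; congr (_ + _).
  by apply: eq_bigl => e; rewrite -andbA.
rewrite [RHS](eq_bigr (fun C => \sum_(j | j == i) F (inr (C, j)))) => [|C _]; last first.
  by rewrite big_pred1_eq.
rewrite (pair_big_dep (fun C => i \in cyc C) (fun C j => j == i) (fun D j => F (inr (D, j)))) /=.
apply: eq_big => [[D j]|[D j] _] //=.
by case: eqP => [->|]; rewrite ?andbF.
Qed.

Lemma sum_all_vars (T : nmodType) (F : U -> T) :
  \sum_(u : Ep) F (val u) =
  \sum_(e in E | old e) F (inl e) + \sum_C \sum_(j <- cyc C) F (inr (C, j)).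
Proof.
rewrite (sum_Ep xpredT) big_sumType /=; congr (_ + _).
  by apply: eq_bigl => e; rewrite andbT.
under [RHS]eq_bigr => C _ do rewrite big_uniq ?cycU //=.
rewrite (pair_big_dep xpredT (fun C j => j \in cyc C) (fun D j => F (inr (D, j)))) /=.
by apply: eq_big => [[D j]|[D j] _] //=; rewrite andbT.
Qed.

(** By disjointness an edge lying on some cycle is counted for exactly one [C]. *)
Lemma sum_E (T : nmodType) (F : {set V} -> T) :
  \sum_(e in E) F e =
  \sum_(e in E | old e) F e + \sum_C \sum_(e in ECset (cyc C)) F e.
Proof.
rewrite (bigID (fun e => in_cycle_edge cyc e)) /= addrC; congr (_ + _).
under [RHS]eq_bigr => C _ do rewrite big_mkcond.
rewrite exchange_big /= big_mkcond; apply: eq_bigr => e _ /=.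
rewrite -big_mkcond; case: ifP => [/andP[eE /existsP[C eC]]|].
  by under eq_bigl => D do rewrite (cyc_unique _ eC) eq_sym; rewrite big_pred1_eq.
move=> /negbT; rewrite negb_and => H; rewrite big_pred0 // => C.
apply/negP => eC; move: H; rewrite (cycE eC) /= => /existsPn /(_ C).
by rewrite eC.
Qed.

(** Linear extension of [xrec] to real vectors, applicable to fractional points and to
    directions. *)
Definition edge_val (z : Ep -> R) (e : {set V}) : R :=
  match [pick C : K | e \in ECset (cyc C)] with
  | Some C => 2^-1 * \sum_(j <- cyc C) (-1) ^+ (dC (cyc C) j e) * zext z (inr (C, j))
  | None => zext z (inl e)
  end.

Lemma xrecE (y : {ffun Ep -> bool}) e : xrec R y e = edge_val (fun u => (y u : nat)%:R) e.
Proof.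
rewrite /xrec /edge_val; case: pickP => [C _|_]; last by rewrite zext_bool.
by congr (_ * _); apply: eq_bigr => j _; rewrite zext_bool.
Qed.

Lemma edge_val_in z C e : e \in ECset (cyc C) -> edge_val z e =
  2^-1 * \sum_(j <- cyc C) (-1) ^+ (dC (cyc C) j e) * zext z (inr (C, j)).
Proof.
move=> eC; rewrite /edge_val; case: pickP => [D|/(_ C)]; last by rewrite eC.
by rewrite (cyc_unique _ eC) => /eqP <-.
Qed.

Lemma edge_val_cyc z C i : i \in cyc C ->
  edge_val z (cedge (cyc C) i) = cval (cyc C) (fun j => zext z (inr (C, j))) i.
Proof. by move=> iC; rewrite (edge_val_in z (cedge_ECset (cycU C) (cyc3 C) iC)). Qed.

Lemma edge_val_old z e : old e -> edge_val z e = zext z (inl e).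
Proof.
rewrite /edge_val; case: pickP => // C eC /existsPn /(_ C).
by rewrite eC.
Qed.

Lemma edge_val_at z C i : i \in cyc C ->
  \sum_(e in ECset (cyc C) | i \in e) edge_val z e = zext z (inr (C, i)).
Proof.
move=> iC; rewrite sum_ECset_at ?cycU ?cyc3 // !edge_val_cyc ?mem_prev //.
by rewrite cval_vertex ?cycU ?cyc3 ?cyco.
Qed.

Lemma cycle_edge_notin C i e : i \notin cyc C -> e \in ECset (cyc C) -> i \notin e.
Proof.
move=> iC /(ECsetP (cycU C) (cyc3 C)) [j jC ->]; apply: contra iC.
by rewrite !inE => /orP[]/eqP -> //; rewrite mem_next.
Qed.

(** A cycle through [i] contributes its two edges at [i] on the left and the one variable [(i_C, i)]
    on the right; these agree by [edge_val_at]. *)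
Lemma edge_val_vertex z i :
  \sum_(e in E | i \in e) edge_val z e = \sum_(u : Ep | memF (inl i) u) z u.
Proof.
under [RHS]eq_bigr => u _ do rewrite -zext_val.
rewrite sum_vertex_factor big_mkcondr sum_E; congr (_ + _).
  rewrite -big_mkcondr; apply: eq_big => [e|e /andP[/andP[_ oe] _]]; first by rewrite andbA.
  by rewrite edge_val_old.
rewrite [RHS]big_mkcond; apply: eq_bigr => C _; rewrite -big_mkcondr.
case: ifP => [/edge_val_at ->//|/negbT iC]; rewrite big1 // => e /andP[eC ie].
by have := cycle_edge_notin iC eC; rewrite ie.
Qed.

(** [wp] is the transpose of [edge_val] applied to [w], so the identity is an exchange of sums. *)
Lemma edge_val_obj z : CLP_obj E w (edge_val z) = \sum_(u : Ep) wp w u * z u.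
Proof.
pose W u := match u with inl e => w e
  | inr (C, j) => 2^-1 * \sum_(e' in ECset (cyc C)) (-1) ^+ (dC (cyc C) j e') * w e' end.
have -> : \sum_(u : Ep) wp w u * z u = \sum_(u : Ep) W (val u) * zext z (val u).
  by apply: eq_bigr => u _; rewrite zext_val.
rewrite (sum_all_vars (fun u => W u * zext z u)) /CLP_obj sum_E; congr (_ + _).
  by apply: eq_bigr => e /andP[_ oe]; rewrite edge_val_old.
apply: eq_bigr => C _; rewrite /W.
under [RHS]eq_bigr => j _ do rewrite -mulrA mulr_suml mulr_sumr.
rewrite exchange_big /=; apply: eq_bigr => e eC; rewrite (edge_val_in z eC).
rewrite mulrCA !mulr_sumr; apply: eq_bigr => j _.
by congr (_ * _); rewrite mulrCA mulrA.
Qed.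

End Transform.

(** * Local assignments *)

Section Local.
Variables (R : realType) (V K : finType) (E : {set {set V}}) (cyc : K -> seq V).
Hypothesis Hcyc : forall C, odd_cycle_of E (cyc C).

Local Notation Ep := (Ep E cyc).
Local Notation U := (U V K).
Local Notation Fac := (Fac V K).
Local Notation conf := {ffun Ep -> bool}.

Definition feas (alpha : Fac) (v : conf) : bool := psi R alpha v != 0.

Lemma psiE alpha (v : conf) : psi R alpha v = (feas alpha v)%:R.
Proof.
by rewrite /feas /psi; case: alpha => ?; case: ifP => _; rewrite ?eqxx ?oner_eq0.
Qed.

Lemma feas_vertexE i (v : conf) :
  feas (inl i) v = (\sum_(u : Ep | memF (inl i) u) (v u : nat) <= 1)%N.
Proof. by rewrite /feas /=; case: ifP; rewrite ?eqxx ?oner_eq0. Qed.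

Lemma feas_vertexP i (v : conf) :
  reflect (forall u u' : Ep, memF (inl i) u -> memF (inl i) u' -> v u -> v u' -> u = u')
          (feas (inl i) v).
Proof.
rewrite feas_vertexE.
have -> : (\sum_(u : Ep | memF (inl i) u) (v u : nat))%N = #|[pred u | memF (inl i) u && v u]|.
  rewrite -sum1_card [RHS](eq_bigl (fun u => memF (inl i) u && v u)) // big_mkcondr /=.
  by apply: eq_bigr => u _; case: (v u).
apply: (iffP card_le1_eqP) => H u u'.
  by move=> *; apply: H; rewrite inE; apply/andP.
by rewrite !inE => /andP[? ?] /andP[? ?]; apply: H.
Qed.

Lemma sum_cyc_yext C (v : conf) :
  (\sum_(u : Ep | memF (inr C) u) (v u : nat) = \sum_(j <- cyc C) (yext v (inr (C, j)) : nat))%N.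
Proof.
rewrite -(sum_cycle_factor Hcyc (fun u => yext v u : nat)).
by apply: eq_bigr => u _; rewrite yext_val.
Qed.

Lemma feas_cycleE C (v : conf) : feas (inr C) v =
  (\sum_(j <- cyc C) (yext v (inr (C, j)) : nat) <= size (cyc C) - 1)%N &&
  all (fun i => (cval (cyc C) (fun j => (yext v (inr (C, j)) : nat)%:R : R) i == 0) ||
                (cval (cyc C) (fun j => (yext v (inr (C, j)) : nat)%:R : R) i == 1)) (cyc C).
Proof.
rewrite /feas /= sum_cyc_yext ltnNge.
case: (_ <= _)%N; rewrite /= ?eqxx //.
have half (s : R) : (2^-1 * s == 0 = (s == 0)) * (2^-1 * s == 1 = (s == 2)).
  split; first by rewrite mulf_eq0 invr_eq0 pnatr_eq0.
  by apply/eqP/eqP => [|->]; [move=> H; lra | rewrite mulVf ?pnatr_eq0].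
case: ifP => [/existsP[e /andP[/(ECsetP (cycU Hcyc C) (cyc3 Hcyc C))[i iC ->]]]|].
  rewrite eqxx -negb_or => /negP H; apply/esym/negP => /allP /(_ i iC).
  by rewrite /cval !half.
move=> /negbT/existsPn H; rewrite oner_eq0; apply/esym/allP => i iC.
have := H (cedge (cyc C) i).
rewrite (cedge_ECset (cycU Hcyc C) (cyc3 Hcyc C) iC) /= -negb_or negbK.
by rewrite /cval !half.
Qed.

(** Through [cval], the sign conditions say that [v] marks the vertices covered by a matching of the
    cycle, [x i] selecting the edge [cedge i]. The bound on the number of marks comes from
    [cval_bool_le]. *)
Lemma feas_cycleP C (v : conf) :
  reflect (exists x : V -> bool, forall i, i \in cyc C ->
            yext v (inr (C, i)) = x i + x (prev (cyc C) i) :> nat)%N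
          (feas (inr C) v).
Proof.
have [[cU c3] co] := (cycU Hcyc C, cyc3 Hcyc C, cyco Hcyc C).
rewrite feas_cycleE; apply: (iffP andP) => [[_ /allP H]|[x Hx]].
  exists (fun i => cval (cyc C) (fun j => (yext v (inr (C, j)) : nat)%:R : R) i == 1).
  move=> i iC; apply/eqP; rewrite -(eqr_nat R) natrD.
  rewrite -(cval_vertex cU c3 co (fun j => (yext v (inr (C, j)) : nat)%:R : R) iC).
  have := H _ iC; have := H (prev (cyc C) i); rewrite mem_prev => /(_ iC).
  case: eqP => [-> _|_ /= /eqP ->]; case: eqP => [-> _|_ /= /eqP ->];
    by rewrite ?eqxx ?(eq_sym 0) ?oner_eq0.
split; first exact: cval_bool_le Hx.
apply/allP => i iC; rewrite (cval_edge cU c3 co (x := fun i => (x i : nat)%:R)) //.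
  by case: (x i); rewrite ?eqxx ?orbT.
by move=> j jC; rewrite Hx // natrD.
Qed.

Definition flip (s : seq Ep) (v : conf) : conf := [ffun x => (x \in s) (+) v x].

(** Here [u] is the only variable [y] selects at [i]. If [v] selects none, [u] can move from [y] to
    [v]; otherwise [g] is the selection of [v] and the two are swapped. *)
Lemma vertex_exchange i (y v : conf) u :
  feas (inl i) y -> feas (inl i) v -> memF (inl i) u -> y u -> ~~ v u ->
  (feas (inl i) (flip [:: u] y) /\ feas (inl i) (flip [:: u] v)) \/
  exists g, [/\ memF (inl i) g, g != u, v g != y g,
    feas (inl i) (flip [:: u; g] y) & feas (inl i) (flip [:: u; g] v)].
Proof.
move=> /feas_vertexP Fy /feas_vertexP Fv iu yu Nvu.
have yN x : memF (inl i) x -> x != u -> y x = false.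
  by move=> ix xu; apply/negP => yx; rewrite (Fy x u) ?eqxx in xu.
case: (pickP (fun g => memF (inl i) g && v g)) => [g /andP[ig vg]|none].
  have gu : g != u by apply: contraNneq Nvu => <-.
  right; exists g; split=> //; first by rewrite vg yN.
  - apply/feas_vertexP => x x' ix ix'; rewrite !ffunE !inE.
    have only z : memF (inl i) z -> (z == u) || (z == g) (+) y z -> z = g.
      move=> iz; case: (eqVneq z u) => [->|zu]; first by rewrite yu.
      by rewrite yN //=; case: eqP.
    by move=> /(only _ ix) -> /(only _ ix') ->.
  - apply/feas_vertexP => x x' ix ix'; rewrite !ffunE !inE.
    have only z : memF (inl i) z -> (z == u) || (z == g) (+) v z -> z = u.
      move=> iz; case: (eqVneq z u) => //= zu; case: (eqVneq z g) => [->|zg] /=; first by rewrite vg.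
      by move=> vz; rewrite (Fv z g) ?eqxx in zg.
    by move=> /(only _ ix) -> /(only _ ix') ->.
left; split; apply/feas_vertexP => x x' ix ix'; rewrite !ffunE !inE.
  by case: (eqVneq x u) => [->|xu]; rewrite ?yu // yN.
have only z : memF (inl i) z -> (z == u) (+) v z -> z = u.
  by move=> iz; have := none z; rewrite iz /= => ->; case: eqP.
by move=> /(only _ ix) -> /(only _ ix') ->.
Qed.

(** The flips come in pairs: a run of edges on which the matchings behind [y] and [v] differ has two
    end vertices, those of [u] and [g]. *)
Lemma cycle_exchange C (y v : conf) u :
  feas (inr C) y -> feas (inr C) v -> memF (inr C) u -> v u != y u ->
  exists g, [/\ memF (inr C) g, g != u, v g != y g,
    feas (inr C) (flip [:: u; g] y) & feas (inr C) (flip [:: u; g] v)].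
Proof.
move=> /feas_cycleP[a Ha] /feas_cycleP[b Hb] Cu vy.
set c := cyc C; have cU : uniq c := cycU Hcyc C.
have [j jC uj] : exists2 j, j \in c & val u = inr (C, j).
  move: Cu (valP u); rewrite memFE; case: (val u) => //= -[D j] /eqP -> jC.
  by exists j.
pose va i := yext y (inr (C, i)); pose vb i := yext v (inr (C, i)).
have vab : va j != vb j by rewrite /va /vb -uj !yext_val eq_sym.
have [pn np] := (prev_next cU, next_prev cU).
have Dn i : i \in c -> next c i \in c by rewrite mem_next.
have Dp i : i \in c -> prev c i \in c by rewrite mem_prev.
suff [h [a' [b' [hC hj abh Hh]]]] : exists h (a' b' : V -> bool),
    [/\ h \in c, h != j, va h != vb h &
     forall i, i \in c ->
     (if i \in [:: j; h] then vb i else va i) = a' i + a' (prev c i) :> nat /\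
     (if i \in [:: j; h] then va i else vb i) = b' i + b' (prev c i) :> nat]%N.
  have [g gh] : exists g : Ep, val g = inr (C, h).
    have hE : inEp E cyc (inr (C, h)) by [].
    by exists (Sub (inr (C, h) : U) hE); rewrite SubK.
  (* As the two assignments differ at both ends of the run, flipping one there copies the other. *)
  have flipE (v1 v2 : conf) i : i \in c ->
      yext v1 (inr (C, j)) != yext v2 (inr (C, j)) ->
      yext v1 (inr (C, h)) != yext v2 (inr (C, h)) ->
      yext (flip [:: u; g] v1) (inr (C, i)) =
      if i \in [:: j; h] then yext v2 (inr (C, i)) else yext v1 (inr (C, i)).
    move=> iC; have iE : inEp E cyc (inr (C, i)) by [].
    pose x : Ep := Sub (inr (C, i) : U) iE; have vx : val x = inr (C, i) by rewrite SubK.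
    rewrite -vx !yext_val ffunE !inE -!(inj_eq val_inj) vx uj gh.
    have eqC k : (inr (C, i) == inr (C, k) :> U) = (i == k).
      by apply/eqP/eqP => [[]|->].
    rewrite !eqC -(yext_val v1) -(yext_val v2) vx.
    case: (eqVneq i j) => [->|_] /=; last case: (eqVneq i h) => [->|_] //=.
      by case: (yext _ _) (yext _ _) => [] [].
    by move=> _; case: (yext _ _) (yext _ _) => [] [].
  exists g; split.
  - by rewrite memFE gh /= eqxx.
  - by rewrite -(inj_eq val_inj) gh uj; apply: contra hj => /eqP[->].
  - by rewrite -!yext_val gh eq_sym.
  - apply/feas_cycleP; exists a' => i iC; rewrite (flipE y v) //.
    by have [] := Hh _ iC.
  - apply/feas_cycleP; exists b' => i iC; rewrite (flipE v y) 1?eq_sym //.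
    by have [] := Hh _ iC.
(* Exactly one of the two edges at [j] is in only one matching. The run is followed forward if it is
   [cedge j], and backward otherwise. *)
have [abj|abj] := eqVneq (a j) (b j); last first.
  apply: (@exchange_run _ _ _ pn np (mem c) a b va vb j Dn jC Ha Hb abj).
  move: (Ha _ jC) (Hb _ jC) vab; rewrite -/(va j) -/(vb j) -/c.
  move: abj. by case: (va j) (vb j) (a j) (b j) (a (prev c j)) (b (prev c j)) => [] [] [] [] [] [].
have abp : a (prev c j) != b (prev c j).
  move: (Ha _ jC) (Hb _ jC) vab; rewrite -/(va j) -/(vb j) -/c abj.
  by case: (va j) (vb j) (b j) (a (prev c j)) (b (prev c j)) => [] [] [] [] [].
(* Traversed backward, an edge is named by its other end. *)
pose a1 i := a (prev c i); pose b1 i := b (prev c i).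
have [|||h [a' [b' [hC hj abh Hh]]]] := @exchange_run _ _ _ np pn (mem c) a1 b1
  va vb j Dp jC _ _ abp.
- by move=> i iC; rewrite /a1 pn addnC; apply: Ha.
- by move=> i iC; rewrite /b1 pn addnC; apply: Hb.
- by rewrite /a1 /b1 pn.
exists h, (fun i => a' (next c i)), (fun i => b' (next c i)); split=> // i iC.
by rewrite np addnC [(b' (next c i) + _)%N]addnC; apply: Hh.
Qed.

Lemma factor_exchange alpha (y v : conf) u :
  feas alpha y -> feas alpha v -> memF alpha u -> v u != y u ->
  (feas alpha (flip [:: u] y) /\ feas alpha (flip [:: u] v)) \/
  exists g, [/\ memF alpha g, g != u, v g != y g,
    feas alpha (flip [:: u; g] y) & feas alpha (flip [:: u; g] v)].
Proof.
case: alpha => [i|C] Fy Fv au vy; last by right; apply: cycle_exchange.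
case yu: (y u) vy => vy.
  by apply: vertex_exchange => //; apply: contraNN vy => /eqP.
have vu : v u by move: vy; case: (v u).
have [[]|[g [ig gu yv ? ?]]] := vertex_exchange Fv Fy au vu (negbT yu); first by left.
by right; exists g; split=> //; rewrite eq_sym.
Qed.

End Local.

(** * Feasible directions *)

Section Polytope.
Variables (R : realType) (V K : finType) (E : {set {set V}}) (cyc : K -> seq V)
          (w : {set V} -> R).
Hypotheses (HE : forall e, e \in E -> #|e| = 2%N)
  (Hcyc : forall C, odd_cycle_of E (cyc C))
  (Hdisj : forall C D, C != D -> [disjoint ECset (cyc C) & ECset (cyc D)]).

Local Notation Ep := (Ep E cyc).
Local Notation U := (U V K).
Local Notation Fac := (Fac V K).
Local Notation conf := {ffun Ep -> bool}.
Local Notation feas := (feas R).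
Local Notation old e := (~~ in_cycle_edge cyc e).

Definition indic (v : conf) (u : Ep) : R := (v u : nat)%:R.

Lemma Pweight_feas (v : conf) : (forall alpha, feas alpha v) ->
  Pweight w v = expR (\sum_u wp w u * indic v u).
Proof.
move=> Fv; rewrite /Pweight [X in _ * X]big1 => [|alpha _]; last by rewrite psiE Fv.
by rewrite mulr1 expR_sum.
Qed.

Lemma Pweight_gt0_feas (v : conf) : 0 < Pweight w v -> forall alpha, feas alpha v.
Proof.
move=> Pv alpha; apply: contraTT Pv => /negbNE/eqP psi0.
by rewrite /Pweight [X in _ * X](bigD1 alpha) //= psi0 mul0r mulr0 ltxx.
Qed.

Lemma zextD (z1 z2 : Ep -> R) a u :
  zext (fun u => z1 u + a * z2 u) u = zext z1 u + a * zext z2 u.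
Proof. by rewrite /zext; case: insub => //=; rewrite mulr0 addr0. Qed.

Lemma edge_valD (z1 z2 : Ep -> R) a e :
  edge_val (fun u => z1 u + a * z2 u) e = edge_val z1 e + a * edge_val z2 e.
Proof.
rewrite /edge_val; case: pickP => [C _|_]; last by rewrite zextD.
rewrite [a * _]mulrCA -mulrDr [a * _]mulr_sumr -big_split; congr (_ * _).
by apply: eq_bigr => j _; rewrite zextD mulrDr [_ * (a * _)]mulrCA.
Qed.

(** Injectivity of [edge_val]: a nonzero direction on the variables stays nonzero in C-LP, where
    uniqueness applies. *)
Lemma edge_val_eq0 (z : Ep -> R) :
  (forall e, e \in E -> edge_val z e = 0) -> forall u, z u = 0.
Proof.
move=> z0 u; rewrite -zext_val; have := valP u.
case: (val u) => [e /andP[eE oe]|[C j] jC].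
  by rewrite -(edge_val_old z oe) z0.
rewrite -(edge_val_at Hcyc Hdisj z jC) big1 // => e /andP[eC _].
by rewrite z0 // (cycE Hcyc eC).
Qed.

Lemma edge_val_feas (v : conf) e : (forall alpha, feas alpha v) -> e \in E ->
  edge_val (indic v) e = 0 \/ edge_val (indic v) e = 1.
Proof.
move=> Fv eE; have [/existsP[C eC]|oe] := boolP (in_cycle_edge cyc e); last first.
  by rewrite edge_val_old // zext_bool; case: (yext _ _); [right|left].
have [i iC ->] := ECsetP (cycU Hcyc C) (cyc3 Hcyc C) _ eC.
rewrite (edge_val_cyc Hcyc Hdisj) //.
have := Fv (inr C); rewrite (feas_cycleE R Hcyc) => /andP[_ /allP /(_ i iC)].
have -> : cval (cyc C) (fun j => zext (indic v) (inr (C, j))) i =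
          cval (cyc C) (fun j => (yext v (inr (C, j)) : nat)%:R : R) i.
  by congr (_ * _); apply: eq_bigr => j _; rewrite zext_bool.
by case/orP => /eqP ->; [left|right].
Qed.

(** Converse of [edge_val_feas]: the variable [(i_C, j)] is set when the matching covers [j] by an
    edge of [C]. *)
Lemma matching_lift (x : {set V} -> bool) :
  (forall i, \sum_(e in E | i \in e) (x e : nat) <= 1)%N ->
  exists v : conf, (forall alpha, feas alpha v) /\
    (forall e, e \in E -> edge_val (indic v) e = (x e : nat)%:R).
Proof.
move=> x1.
pose X (u : U) := match u with inl e => x e
  | inr (C, j) => x (cedge (cyc C) j) || x (cedge (cyc C) (prev (cyc C) j)) end.
pose v : conf := [ffun u => X (val u)]; exists v.
have [[cU c3] co] := (cycU Hcyc, cyc3 Hcyc, cyco Hcyc).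
have vC C i : i \in cyc C -> (yext v (inr (C, i)) : nat) =
    (x (cedge (cyc C) i) + x (cedge (cyc C) (prev (cyc C) i)))%N.
  move=> iC; have iE : inEp E cyc (inr (C, i)) by [].
  rewrite -[inr (C, i)]/(val (Sub (inr (C, i) : U) iE : Ep)) yext_val ffunE /=.
  have := leq_trans _ (x1 i) => /(_ (\sum_(e in ECset (cyc C) | i \in e) (x e : nat))%N).
  have sub : (\sum_(e in ECset (cyc C) | i \in e) (x e : nat) <=
              \sum_(e in E | i \in e) (x e : nat))%N.
    rewrite [leqLHS]big_mkcond [leqRHS]big_mkcond leq_sum // => e _ /=.
    by case: ifP => // /andP[/(cycE Hcyc) -> ->].
  move=> /(_ sub); rewrite (sum_ECset_at (cU C) (c3 C) (fun e => x e : nat) iC).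
  by case: (x _) (x _) => [] [].
have ev e : e \in E -> edge_val (indic v) e = (x e : nat)%:R.
  move=> eE; have [/existsP[C eC]|oe] := boolP (in_cycle_edge cyc e).
    have [i iC ->] := ECsetP (cU C) (c3 C) _ eC.
    rewrite (edge_val_cyc Hcyc Hdisj) //.
    apply: (cval_edge (cU C) (c3 C) (co C) (x := fun i => (x (cedge (cyc C) i) : nat)%:R)) => //.
    by move=> j jC; rewrite zext_bool vC // natrD.
  rewrite edge_val_old // zext_bool.
  have eE' : inEp E cyc (inl e) by rewrite /= eE oe.
  by rewrite -[inl e]/(val (Sub (inl e : U) eE' : Ep)) yext_val ffunE.
split=> // -[i|C]; last first.
  by apply/(feas_cycleP _ Hcyc); exists (fun i => x (cedge (cyc C) i)); apply: vC.
rewrite feas_vertexE -(ler_nat R) natr_sum.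
have := edge_val_vertex Hcyc Hdisj (indic v) i; rewrite /indic => <-.
under eq_bigr => e /andP[eE _] do rewrite ev //.
by rewrite -natr_sum ler_nat.
Qed.

Variable y : conf.
Hypothesis ymap : is_MAP w y.

(** The empty matching lifts to an assignment of positive weight, so the maximum is positive. *)
Lemma map_feas alpha : feas alpha y.
Proof.
apply: Pweight_gt0_feas; have [i|v [Fv _]] := @matching_lift (fun=> false).
  by rewrite big1.
by apply: lt_le_trans (ymap v); rewrite Pweight_feas // expR_gt0.
Qed.

Lemma map_opt (v : conf) : (forall alpha, feas alpha v) ->
  \sum_u wp w u * indic v u <= \sum_u wp w u * indic y u.
Proof.
move=> Fv; have := ymap v; rewrite !Pweight_feas ?ler_expR //.
exact: map_feas.
Qed.

(* [d] is, near the factor [alpha], a feasible direction at the MAP assignment [y]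
   of the polytope spanned by the local assignments that [psi alpha] accepts. *)
Definition fdir (alpha : Fac) (d : Ep -> R) : Prop :=
  exists2 l : seq conf, all (feas alpha) l &
    forall u, memF alpha u -> d u = \sum_(v <- l) (indic v u - indic y u).

Lemma fdir_eq alpha d d' : (forall u, memF alpha u -> d u = d' u) ->
  fdir alpha d -> fdir alpha d'.
Proof. by move=> dd' [l Fl dl]; exists l => // u au; rewrite -dd' ?dl. Qed.

Lemma fdir0 alpha : fdir alpha (fun=> 0).
Proof. by exists [::] => // u _; rewrite big_nil. Qed.

Lemma fdirD alpha d d' : fdir alpha d -> fdir alpha d' -> fdir alpha (fun u => d u + d' u).
Proof.
move=> [l Fl dl] [l' Fl' dl']; exists (l ++ l'); first by rewrite all_cat Fl.
by move=> u au; rewrite big_cat /= dl ?dl'.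
Qed.

Lemma fdir1 alpha v : feas alpha v -> fdir alpha (fun u => indic v u - indic y u).
Proof. by move=> Fv; exists [:: v]; rewrite /= ?Fv // => u _; rewrite big_seq1. Qed.

(** If [N] is at least the length of the list for [alpha], then [y] plus [1 / N] of the direction is
    near [alpha] a convex combination of [y] and the listed assignments. One [N] serves all factors.
    Membership in the hull is expressed by the linear inequalities valid on accepted assignments. *)
Lemma fdir_step (d : Ep -> R) : (forall alpha, fdir alpha d) ->
  exists2 a : R, 0 < a & forall alpha (c : Ep -> R) b,
    (forall v, feas alpha v -> \sum_(u | memF alpha u) c u * indic v u <= b) ->
    \sum_(u | memF alpha u) c u * (indic y u + a * d u) <= b.
Proof.
move=> fd; have [l] : exists l : Fac -> seq conf, forall alpha,
    all (feas alpha) (l alpha) /\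
    forall u, memF alpha u -> d u = \sum_(v <- l alpha) (indic v u - indic y u).
  apply: (@fin_all_exists _ (fun=> seq conf) (fun alpha l => all (feas alpha) l /\
    forall u, memF alpha u -> d u = \sum_(v <- l) (indic v u - indic y u))) => alpha.
  by have [l] := fd alpha; exists l.
move=> lP; pose N := (\sum_alpha size (l alpha)).+1.
have N0 : 0 < N%:R :> R by rewrite ltr0n.
exists N%:R^-1 => [|alpha c b cb]; first by rewrite invr_gt0.
have [/allP Fl dl] := lP alpha.
pose L (v : conf) := \sum_(u | memF alpha u) c u * indic v u.
have -> : \sum_(u | memF alpha u) c u * (indic y u + N%:R^-1 * d u) =
          L y + N%:R^-1 * \sum_(v <- l alpha) (L v - L y).
  under eq_bigr => u au do rewrite mulrDr mulrCA dl // mulr_sumr.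
  rewrite big_split -mulr_sumr /=; congr (_ + _ * _).
  rewrite exchange_big /=; apply: eq_bigr => v _.
  by rewrite /L -sumrB; apply: eq_bigr => u _; rewrite mulrBr.
rewrite -lerBrDl mulrC ler_pdivrMr //.
have le1 : \sum_(v <- l alpha) (L v - L y) <= \sum_(v <- l alpha) (b - L y).
  rewrite big_seq [leRHS]big_seq; apply: ler_sum => v vl.
  by rewrite lerD2r cb // Fl.
apply: (le_trans le1).
rewrite big_const_seq count_predT iter_addr_0 -[leLHS]mulr_natr ler_wpM2l //.
  by rewrite subr_ge0 cb // map_feas.
by rewrite ler_nat /N (bigD1 alpha) //= leqW // leq_addr.
Qed.

(** Each constraint of C-LP is a linear inequality in the variables of one factor, valid on what
    that factor accepts. The bounds on an edge come from its cycle, or else from one of its end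
    vertices. *)
Lemma CLP_feasible_local (z : Ep -> R) :
  (forall alpha (c : Ep -> R) b,
    (forall v, feas alpha v -> \sum_(u | memF alpha u) c u * indic v u <= b) ->
    \sum_(u | memF alpha u) c u * z u <= b) ->
  CLP_feasible E cyc (edge_val z).
Proof.
move=> H; have bnd alpha (c : Ep -> R) b b' :
    (forall v, feas alpha v -> b' <= \sum_(u | memF alpha u) c u * indic v u <= b) ->
    b' <= \sum_(u | memF alpha u) c u * z u <= b.
  move=> Hb; rewrite H => [|v /Hb /andP[]//]; rewrite andbT -lerN2 -sumrN.
  under eq_bigr => u _ do rewrite -mulNr.
  apply: H => v /Hb /andP[Hb' _]; rewrite -lerN2 opprK -sumrN.
  by under eq_bigr => u _ do rewrite mulNr opprK.
have cycsum C (F : U -> R) (x : Ep -> R) : \sum_(u | memF (inr C) u) F (val u) * x u =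
    \sum_(j <- cyc C) F (inr (C, j)) * zext x (inr (C, j)).
  rewrite -(sum_cycle_factor Hcyc (fun u => F u * zext x u)).
  by apply: eq_bigr => u _; rewrite zext_val.
split=> [i|C|e eE].
- rewrite (edge_val_vertex Hcyc Hdisj).
  under eq_bigr => u _ do rewrite -[z u]mul1r.
  apply: H => v; rewrite feas_vertexE -(ler_nat R) natr_sum => Hv.
  by under eq_bigr => u _ do rewrite mul1r.
- have [[cU c3] co] := (cycU Hcyc C, cyc3 Hcyc C, cyco Hcyc C).
  rewrite (sum_ECset cU c3) (eq_big_seq _ (fun i iC => edge_val_cyc Hcyc Hdisj z iC)).
  rewrite sum_cval // mulr_sumr -(cycsum C (fun=> 2^-1)).
  apply: H => v; rewrite (feas_cycleE R Hcyc) => /andP[Hv _].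
  rewrite -mulr_sumr mulrC ler_pM2r ?invr_gt0 ?ltr0n //.
  have -> : (size (cyc C))%:R - 1 = (size (cyc C) - 1)%:R :> R.
    by rewrite natrB // (leq_trans _ c3).
  suff -> : \sum_(u | memF (inr C) u) indic v u =
      (\sum_(j <- cyc C) (yext v (inr (C, j)) : nat))%N%:R :> R by rewrite ler_nat.
  transitivity (\sum_(u | memF (inr C) u) 1 * indic v u).
    by apply: eq_bigr => u _; rewrite mul1r.
  rewrite (cycsum C (fun=> 1)) natr_sum.
  by apply: eq_bigr => j _; rewrite mul1r zext_bool.
- have [/existsP[C eC]|oe] := boolP (in_cycle_edge cyc e).
    pose F (u : U) : R := if u is inr (_, j) then 2^-1 * (-1) ^+ dC (cyc C) j e else 0.
    have Fx (x : Ep -> R) : edge_val x e = \sum_(u | memF (inr C) u) F (val u) * x u.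
      rewrite (edge_val_in Hdisj x eC) cycsum mulr_sumr.
      by apply: eq_bigr => j _; rewrite mulrA.
    rewrite Fx; apply: bnd => v; rewrite -Fx.
    have [i iC ->] := ECsetP (cycU Hcyc C) (cyc3 Hcyc C) _ eC.
    rewrite (edge_val_cyc Hcyc Hdisj) //.
    rewrite (feas_cycleE R Hcyc) => /andP[_ /allP /(_ i iC)].
    have -> : cval (cyc C) (fun j => zext (indic v) (inr (C, j))) i =
          cval (cyc C) (fun j => (yext v (inr (C, j)) : nat)%:R : R) i.
      by congr (_ * _); apply: eq_bigr => j _; rewrite zext_bool.
    by case/orP => /eqP ->; rewrite ?lexx ler01.
  have eE' : inEp E cyc (inl e) by rewrite /= eE oe.
  pose u : Ep := Sub (inl e : U) eE'.
  have [i ie] : exists i, i \in e by apply/set0Pn; rewrite -card_gt0 HE.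
  have Fx (x : Ep -> R) : edge_val x e = \sum_(u' | memF (inl i) u') (u' == u)%:R * x u'.
    rewrite edge_val_old // -[inl e]/(val u) zext_val (bigD1 u) ?memFE //=.
    by rewrite eqxx mul1r big1 ?addr0 // => u' /andP[_ /negPf ->]; rewrite mul0r.
  rewrite Fx; apply: bnd => v _; rewrite -Fx edge_val_old // zext_bool.
  by case: (yext _ _); rewrite ?lexx ler01.
Qed.

Hypothesis Hlp : CLP_unique_integral_opt E w cyc.

(* Moving slightly along [d] stays in C-LP, and uniqueness makes the move a strict loss. *)
Lemma flow_neg (d : Ep -> R) u0 : (forall alpha, fdir alpha d) -> d u0 != 0 ->
  \sum_u wp w u * d u < 0.
Proof.
move=> fd du0; rewrite ltNge; apply: contra du0 => d_ge0; apply/eqP.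
have [x0 [[x0F x0opt] x0uniq x0int]] := Hlp.
have [a a0 Ha] := fdir_step fd.
(* The zero direction gives feasibility of [y] itself. *)
have [b b0 Hb] := fdir_step (fun alpha => fdir0 alpha).
have yF : CLP_feasible E cyc (edge_val (indic y)).
  apply: CLP_feasible_local => alpha c b' /Hb; apply: le_trans; rewrite le_eqVlt; apply/orP; left; apply/eqP.
  by apply: eq_bigr => u _; rewrite mulr0 addr0.
have zF : CLP_feasible E cyc (edge_val (fun u => indic y u + a * d u)).
  exact: CLP_feasible_local.
(* Integrality enters here: [x0] lifts to an accepted assignment, which cannot beat the MAP
   assignment. *)
have y_ge : CLP_obj E w x0 <= CLP_obj E w (edge_val (indic y)).
  have x0E e : e \in E -> x0 e = ((x0 e == 1) : nat)%:R.
    by move=> /x0int [] ->; rewrite ?eqxx // eq_sym oner_eq0.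
  have [i|v [Fv ev]] := @matching_lift (fun e => x0 e == 1).
    have [/(_ i) + _ _] := x0F; rewrite -(ler_nat R) natr_sum; apply: le_trans.
    by rewrite le_eqVlt; apply/orP; left; apply/eqP; apply: eq_bigr => e /andP[eE _]; rewrite [RHS]x0E.
  have -> : CLP_obj E w x0 = CLP_obj E w (edge_val (indic v)).
    by apply: eq_bigr => e eE; rewrite ev // -x0E.
  by rewrite !(edge_val_obj w Hcyc Hdisj) map_opt.
have opt x : CLP_feasible E cyc x -> CLP_obj E w (edge_val (indic y)) <= CLP_obj E w x ->
    forall e, e \in E -> x e = x0 e.
  move=> xF yx; apply: x0uniq; split=> // x' /x0opt; move/le_trans; apply.
  exact: le_trans yx.
(* Were the weight of [d] nonnegative, [y] and [y + a * d] would both map to [x0]. *)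
apply: edge_val_eq0 => e eE.
have := opt _ zF _ e eE; rewrite -(opt _ yF (lexx _) e eE) edge_valD.
rewrite !(edge_val_obj w Hcyc Hdisj).
under [X in _ <= X]eq_bigr => u _ do rewrite mulrDr mulrCA.
rewrite big_split /= lerDl -mulr_sumr mulr_ge0 ?(ltW a0) // => /(_ isT)/eqP.
by rewrite -subr_eq0 addrC addKr mulf_eq0 gt_eqF //= => /eqP.
Qed.

End Polytope.

(** * Belief propagation *)

Lemma bigmax_attained (R : realDomainType) (I : finType) (P : pred I) (F : I -> R) :
  \big[Num.max/0]_(i | P i) F i = 0 \/
  exists2 i, P i & \big[Num.max/0]_(i | P i) F i = F i.
Proof.
elim/big_rec: _ => [|i x Pi IH]; first by left.
by case: (leP (F i) x) => _ //; right; exists i.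
Qed.

Section BP.
Variables (R : realType) (V K : finType) (E : {set {set V}}) (cyc : K -> seq V)
          (w : {set V} -> R).
Hypotheses (HE : forall e, e \in E -> #|e| = 2%N)
  (Hcyc : forall C, odd_cycle_of E (cyc C))
  (Hdisj : forall C D, C != D -> [disjoint ECset (cyc C) & ECset (cyc D)]).

Local Notation Ep := (Ep E cyc).
Local Notation Fac := (Fac V K).
Local Notation conf := {ffun Ep -> bool}.
Local Notation feas := (feas R).
Local Notation indic := (@indic R V K E cyc).

(** * The two factors of a variable *)

Definition oth (u : Ep) (alpha : Fac) : Fac :=
  odflt alpha [pick beta | memF beta u && (beta != alpha)].

Lemma two_factors (u : Ep) : exists a b : Fac,
  a != b /\ forall alpha, memF alpha u = (alpha == a) || (alpha == b).
Proof.
have := valP u; case Eu: (val u) => [e|[C j]] /= => [/andP[eE _]|jC].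
  have /eqP/cards2P[a [b [ab e_ab]]] := HE eE.
  exists (inl a), (inl b); split=> [|alpha]; first by apply: contra ab => /eqP[->].
  rewrite memFE Eu; case: alpha => //= i.
  have inlE x : (inl i == inl x :> Fac) = (i == x) by apply/eqP/eqP => [[]|->].
  by rewrite e_ab !inE !inlE.
exists (inl j), (inr C); split=> // alpha; rewrite memFE Eu; case: alpha => x.
  by rewrite -[RHS]/((x == j) || false) orbF /= eq_sym.
by rewrite -[RHS]/(false || (x == C)) /= eq_sym.
Qed.

Lemma othP (u : Ep) alpha : memF alpha u ->
  oth u alpha != alpha /\ forall beta, memF beta u = (beta == alpha) || (beta == oth u alpha).
Proof.
have [a [b [ab abP]]] := two_factors u.
rewrite /oth abP => /orP[]/eqP ->; case: pickP => [beta|].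
- rewrite abP => /andP[/orP[]/eqP ->]; first by rewrite eqxx.
  by move=> ba; split.
- by move=> /(_ b); rewrite abP eqxx orbT /= eq_sym ab.
- rewrite abP => /andP[/orP[]/eqP -> H]; last by rewrite eqxx in H.
  by split=> // beta'; rewrite abP orbC.
- by move=> /(_ a); rewrite abP eqxx /= ab.
Qed.

Lemma oth_mem (u : Ep) alpha : memF alpha u -> memF (oth u alpha) u.
Proof. by move=> /othP[_ ->]; rewrite eqxx orbT. Qed.

Lemma oth_inv (u : Ep) alpha : memF alpha u -> oth u (oth u alpha) = alpha.
Proof.
move=> au; have [Noa othE] := othP au; have [Nooa oothE] := othP (oth_mem au).
have := oothE (oth u (oth u alpha)); rewrite eqxx orbT othE => /orP[/eqP //|/eqP e].
by rewrite e eqxx in Nooa.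
Qed.

Lemma prod_other (u : Ep) alpha (F : Fac -> R) : memF alpha u ->
  \prod_(a | memF a u && (a != alpha)) F a = F (oth u alpha).
Proof.
move=> au; have [Noa othE] := othP au; rewrite (big_pred1 (oth u alpha)) // => a.
by rewrite othE; case: eqVneq => [->|_] //=; rewrite ?andbT // eq_sym (negPf Noa).
Qed.

Lemma prod_both (u : Ep) alpha (F : Fac -> R) : memF alpha u ->
  \prod_(a | memF a u) F a = F alpha * F (oth u alpha).
Proof. by move=> au; rewrite (bigD1 alpha) //= prod_other. Qed.

Variable y : conf.
Hypothesis ymap : is_MAP w y.
Hypothesis Hlp : CLP_unique_integral_opt E w cyc.

(** * Walks of admissible flips and their directions *)

Definition sgn (u : Ep) : R := 1 - 2 * indic y u.
Definition fl (u x : Ep) : R := (x == u)%:R * sgn u.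

(* A state [(u, alpha)] stands for the message from variable [u] to factor [alpha];
   that message is computed from those arriving at the other factor of [u]. *)
Local Notation state := (Ep * Fac)%type.
Definition wt (s : state) : R := wp w s.1 * sgn s.1.

(** A step follows the computation backwards: the message [(u, alpha)] depends, through
    [beta = oth u alpha], on messages [(g, beta)], and [beta] must accept flipping [u] and [g]
    together. *)
Definition step : rel state := fun s s' =>
  [&& s'.2 == oth s.1 s.2, memF s'.2 s'.1, s'.1 != s.1 & feas s'.2 (flip [:: s.1; s'.1] y)].

Definition stop : pred state := fun s => feas (oth s.1 s.2) (flip [:: s.1] y).

Lemma sgn_neq0 u : sgn u != 0.
Proof. by rewrite /sgn /indic; case: (y u); apply/eqP => /=; lra. Qed.

Lemma flip1_dir u x : indic (flip [:: u] y) x - indic y x = fl u x.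
Proof.
rewrite /fl /sgn /indic ffunE inE; case: eqVneq => [->|_] /=; last by rewrite mul0r subrr.
by case: (y u) => /=; lra.
Qed.

Lemma flip2_dir u g x : g != u ->
  indic (flip [:: u; g] y) x - indic y x = fl u x + fl g x.
Proof.
move=> gu; rewrite -!flip1_dir /indic !ffunE !inE.
case: (eqVneq x u) => [->|_] /=; last by rewrite !subrr add0r.
by rewrite eq_sym (negPf gu) /= !subrr addr0.
Qed.

Lemma fl_split (u x : Ep) alpha beta : memF alpha u -> memF beta x ->
  fl u x = (alpha == beta)%:R * fl u x + (oth u alpha == beta)%:R * fl u x.
Proof.
rewrite /fl; case: eqVneq => [->|_ _ _]; last by rewrite !mul0r !mulr0 addr0.
move=> /othP[Noa othE]; rewrite othE => /orP[]/eqP ->; rewrite eqxx ?(negPf Noa).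
  by rewrite mul0r addr0 !mul1r.
by rewrite eq_sym (negPf Noa) mul0r add0r !mul1r.
Qed.

(** Each step is a feasible direction at its own factor. An inner state takes part in two steps, one
    at each factor of its variable; the two end states take part in one only, whence the correction
    terms. *)
Lemma path_fdir alpha p s : memF s.2 s.1 -> path step s p ->
  fdir y alpha (fun x => \sum_(t <- belast s p) fl t.1 x
    + ((last s p).2 == alpha)%:R * fl (last s p).1 x - (s.2 == alpha)%:R * fl s.1 x).
Proof.
elim: p s => [|s' p IH] s /= su.
  move=> _; apply: (fdir_eq _ (fdir0 R y alpha)) => x _; rewrite big_nil; lra.
case/andP=> /and4P[/eqP s'2 s'm s's Fs'] /(IH _ s'm) {}IH.
have dir : fdir y alpha (fun x => (s'.2 == alpha)%:R * (fl s.1 x + fl s'.1 x)).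
  case: eqVneq => [<-|_].
    by apply: (fdir_eq _ (fdir1 y Fs')) => x _; rewrite flip2_dir // mul1r.
  by apply: (fdir_eq _ (fdir0 R y alpha)) => x _; rewrite mul0r.
apply: (fdir_eq _ (fdirD IH dir)) => x ax; rewrite big_cons.
rewrite [X in _ = X + _ + _ - _](fl_split su ax) -s'2; ring.
Qed.

Lemma path_stop_fdir alpha p s : memF s.2 s.1 -> path step s p -> stop (last s p) ->
  fdir y alpha (fun x => \sum_(t <- s :: p) fl t.1 x - (s.2 == alpha)%:R * fl s.1 x).
Proof.
move=> su sp tp; have := path_fdir alpha su sp.
have tm : memF (last s p).2 (last s p).1.
  elim: p s su sp {tp} => //= s' p IH s _ /andP[/and4P[_ s'm _ _]]; exact: IH.
move=> D1; have dir : fdir y alpha (fun x =>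
    (oth (last s p).1 (last s p).2 == alpha)%:R * fl (last s p).1 x).
  case: eqVneq => [<-|_].
    by apply: (fdir_eq _ (fdir1 y tp)) => x _; rewrite flip1_dir mul1r.
  by apply: (fdir_eq _ (fdir0 R y alpha)) => x _; rewrite mul0r.
apply: (fdir_eq _ (fdirD D1 dir)) => x ax.
rewrite lastI -cats1 big_cat big_seq1 /= [X in _ = _ + X - _](fl_split tm ax); ring.
Qed.

Lemma sum_fl (l : seq state) x :
  \sum_(t <- l) fl t.1 x = (count (fun t => x == t.1) l)%:R * sgn x.
Proof.
elim: l => [|t l IH]; first by rewrite big_nil mul0r.
rewrite big_cons IH /= natrD mulrDl /fl; congr (_ + _).
by case: eqVneq => [->|_] //; rewrite !mul0r.
Qed.

Lemma sum_wp_fl u : \sum_x wp w x * fl u x = wp w u * sgn u.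
Proof.
rewrite (bigD1 u) //= /fl eqxx mul1r big1 ?addr0 // => x /negPf ->.
by rewrite mul0r mulr0.
Qed.

Lemma sum_wp_fls (l : seq state) :
  \sum_x wp w x * (\sum_(t <- l) fl t.1 x) = \sum_(t <- l) wt t.
Proof.
under eq_bigr => x _ do rewrite mulr_sumr.
by rewrite exchange_big; apply: eq_bigr => t _; rewrite sum_wp_fl.
Qed.

Lemma step_mem s s' : step s s' -> memF s'.2 s'.1.
Proof. by case/and4P. Qed.

(** The corrections at the two ends cancel. The direction is nonzero because all flips of one
    variable have the same sign. *)
Lemma closed_walk_neg s p : path step s p -> p != [::] -> last s p = s ->
  \sum_(t <- p) wt t < 0.
Proof.
move=> sp p0 lp.
have sm : memF s.2 s.1.
  case/lastP: p sp lp p0 => [//|p s'].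
  by rewrite rcons_path last_rcons => /andP[_ /step_mem] + <-.
have -> : \sum_(t <- p) wt t = \sum_(t <- belast s p) wt t.
  have /(congr1 (fun l => \sum_(t <- l) wt t)) := lastI s p.
  by rewrite lp big_cons -cats1 big_cat big_seq1 /= => e; lra.
rewrite -sum_wp_fls.
apply: (flow_neg HE Hcyc Hdisj ymap Hlp (u0 := s.1)) => [alpha|].
  apply: (fdir_eq _ (path_fdir alpha sm sp)) => x _; rewrite lp; ring.
rewrite sum_fl mulf_neq0 ?sgn_neq0 // pnatr_eq0 -lt0n -has_count.
by case: p p0 {sp lp} => //= s' p _; rewrite eqxx.
Qed.

(** The walks leave [u] on its two sides, so their start corrections add up to one copy of the flip
    of [u]. After its removal [u] is still flipped at least once. *)
Lemma double_stop_neg u alpha p1 p2 : memF alpha u ->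
  path step (u, alpha) p1 -> stop (last (u, alpha) p1) ->
  path step (u, oth u alpha) p2 -> stop (last (u, oth u alpha) p2) ->
  \sum_(t <- (u, alpha) :: p1) wt t + \sum_(t <- (u, oth u alpha) :: p2) wt t
    - wp w u * sgn u < 0.
Proof.
move=> au p1P s1 p2P s2.
rewrite -sum_wp_fl -!sum_wp_fls -big_split -sumrB /=.
under eq_bigr => x _ do rewrite -mulrDr -mulrBr.
apply: (flow_neg HE Hcyc Hdisj ymap Hlp (u0 := u)) => [beta|].
  have D1 := path_stop_fdir beta (au : memF (u, alpha).2 (u, alpha).1) p1P s1.
  have D2 := path_stop_fdir beta
    (oth_mem au : memF (u, oth u alpha).2 (u, oth u alpha).1) p2P s2.
  apply: (fdir_eq _ (fdirD D1 D2)) => x bx /=.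
  rewrite [X in _ = _ - X](fl_split au bx); ring.
rewrite !sum_fl /= !eqxx /fl eqxx -mulrDl -mulrBl mulf_neq0 ?sgn_neq0 //.
rewrite -natrD -natrB ?pnatr_eq0; last by lia.
by rewrite -lt0n; lia.
Qed.

(** * Comparison of messages along walks *)

Local Notation msg t := (msgs_at E cyc w t).

Lemma v2f_succ t u alpha z : memF alpha u ->
  v2f (msg t.+1) u alpha z = expR (wp w u * (z : nat)%:R) * f2v (msg t) (oth u alpha) u z.
Proof. by move=> au; rewrite /= prod_other. Qed.

Definition contrib t alpha u (v : conf) : R :=
  psi R alpha v * \prod_(f : Ep | memF alpha f && (f != u)) v2f (msg t) f alpha (v f).

Lemma f2v_succ t alpha u z : f2v (msg t.+1) alpha u z =
  \big[Num.max/0]_(v : conf | v u == z) contrib t alpha u v.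
Proof. by []. Qed.

Lemma msg_ge0 t : (forall alpha u z, 0 <= f2v (msg t) alpha u z) /\
  (forall u alpha z, 0 <= v2f (msg t) u alpha z).
Proof.
elim: t => [|t [IH1 IH2]]; first by split=> *; rewrite ler01.
split=> [alpha u z|u alpha z] /=; first exact: bigmax_ge_id.
by rewrite mulr_ge0 ?expR_ge0 // prodr_ge0.
Qed.

(** [y] is accepted by every factor and competes in each maximum, so ratios to the right value make
    sense. *)
Lemma msg_map_gt0 t : (forall alpha u, 0 < f2v (msg t) alpha u (y u)) /\
  (forall u alpha, 0 < v2f (msg t) u alpha (y u)).
Proof.
elim: t => [|t [IH1 IH2]]; first by split=> *; rewrite ltr01.
split=> [alpha u|u alpha]; last by rewrite /= mulr_gt0 ?expR_gt0 // prodr_gt0.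
rewrite f2v_succ; set F := contrib t alpha u.
have Fy : 0 < F y by rewrite /F /contrib psiE (map_feas Hcyc Hdisj ymap) mul1r prodr_gt0.
exact: lt_le_trans Fy (le_bigmax_cond 0 (P := fun v : conf => v u == y u) F (eqxx _)).
Qed.

(** A best [v] with the wrong value at [u] is exchanged against [y]. The flipped [v] competes for
    the right value, and apart from [psi] only the message of [g], if any, distinguishes the two
    products. *)
Lemma f2v_ratio t beta u : memF beta u ->
  [\/ f2v (msg t.+1) beta u (~~ y u) = 0,
      feas beta (flip [:: u] y) /\
        f2v (msg t.+1) beta u (~~ y u) <= f2v (msg t.+1) beta u (y u)
    | exists g, [/\ memF beta g, g != u, feas beta (flip [:: u; g] y) &
        forall c, v2f (msg t) g beta (~~ y g) <= c * v2f (msg t) g beta (y g) ->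
          f2v (msg t.+1) beta u (~~ y u) <= c * f2v (msg t.+1) beta u (y u)]].
Proof.
move=> bu; rewrite !f2v_succ.
set F := contrib t beta u.
have [->|[v /eqP vu Fv]] := bigmax_attained (fun v : conf => v u == ~~ y u) F.
  by constructor 1.
have [Fb|/negbNE/eqP psi0] := boolP (feas beta v); last first.
  by constructor 1; rewrite Fv /F /contrib psi0 mul0r.
have vyu : v u != y u by rewrite vu; case: (y u).
have le_F (v' : conf) : v' u = y u ->
    F v' <= \big[Num.max/0]_(v : conf | v u == y u) F v.
  by move=> v'u; apply: (@le_bigmax_cond _ _ _ 0 v' (fun v : conf => v u == y u) F); apply/eqP.
have [[Fy Fv1]|[g [bg gu vg Fy Fv2]]] :=
  factor_exchange Hcyc (map_feas Hcyc Hdisj ymap beta) Fb bu vyu.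
  constructor 2; split=> //; rewrite Fv; apply: le_trans (le_F (flip [:: u] v) _); last first.
    by rewrite ffunE inE eqxx vu; case: (y u).
  rewrite /F /contrib !psiE Fb Fv1 !mul1r le_eqVlt; apply/orP; left; apply/eqP.
  by apply: eq_bigr => f /andP[_ fu]; rewrite ffunE inE (negPf fu).
constructor 3; exists g; split=> // c Hc.
have Fc : F v <= c * F (flip [:: u; g] v).
  rewrite /F /contrib !psiE Fb Fv2 !mul1r.
  rewrite (bigD1 g) ?bg //= [in X in _ <= _ * X](bigD1 g) ?bg //= mulrA.
  rewrite (eq_bigr (fun f => v2f (msg t) f beta (flip [:: u; g] v f))); last first.
    by move=> f /andP[/andP[_ fu] fg]; rewrite ffunE !inE (negPf fu) (negPf fg).
  have vg' : v g = ~~ y g by move: vg; case: (v g) (y g) => [] [].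
  rewrite ler_wpM2r //; last by rewrite ffunE !inE eqxx orbT vg' addTb negbK.
  by apply: prodr_ge0 => f _; have [_] := msg_ge0 t; apply.
have [v0|vpos] := eqVneq (v2f (msg t) g beta (~~ y g)) 0.
  have c0 : 0 <= c.
    have [_ /(_ g beta) yg] := msg_map_gt0 t; move: Hc.
    by rewrite v0 pmulr_lge0.
  by rewrite Fv (le_trans Fc) // ler_wpM2l // le_F // ffunE !inE eqxx /= vu negbK.
have c0 : 0 <= c.
  have [_ /(_ g beta) yg] := msg_map_gt0 t; have [_ /(_ g beta (~~ y g)) ng] := msg_ge0 t.
  by have := le_trans ng Hc; rewrite pmulr_lge0.
by rewrite Fv (le_trans Fc) // ler_wpM2l // le_F // ffunE !inE eqxx /= vu negbK.
Qed.

Lemma expR_flip u : expR (wp w u * (~~ y u : nat)%:R) =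
  expR (wp w u * sgn u) * expR (wp w u * (y u : nat)%:R).
Proof.
by rewrite -expRD; congr expR; rewrite /sgn /indic; case: (y u) => /=; ring.
Qed.

(* The disadvantage of the wrong value in a message is the weight of a walk that
   either stops or runs through about [t / 2] states. *)
Lemma v2f_ratio b (Hb : forall s, `|wt s| <= b) t u alpha : memF alpha u ->
  v2f (msg t) u alpha (~~ y u) = 0 \/
  exists p W, [/\ path step (u, alpha) p,
    v2f (msg t) u alpha (~~ y u) <= expR W * v2f (msg t) u alpha (y u) &
    (stop (last (u, alpha) p) /\ W = \sum_(s <- (u, alpha) :: p) wt s) \/
    (W <= \sum_(s <- (u, alpha) :: p) wt s + b /\ (t <= (size p).*2.+1)%N)].
Proof.
(* Messages at time [t + 2] depend on those at time [t]. At time 0 all messages are 1, so [W = 0]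
   leaves out the weight of the state, which [b] absorbs. *)
elim/ltn_ind: t u alpha => -[|[|t]] IH u alpha au.
- right; exists [::], 0; split=> //=; first by rewrite expR0 mul1r.
  right; rewrite big_seq1; split=> //.
  by have := Hb (u, alpha); rewrite ler_norml => /andP[+ _]; lra.
- right; exists [::], (wt (u, alpha)); split=> //.
    by rewrite !v2f_succ // expR_flip /= mulrA.
  right; rewrite big_seq1; split=> //.
  by have := Hb (u, alpha); rewrite ler_norml => /andP[+ +]; lra.
have bu := oth_mem au; set beta := oth u alpha in bu.
rewrite !(v2f_succ _ _ au) expR_flip -/beta -/(wt (u, alpha)).
have e0 : 0 < expR (wp w u * (y u : nat)%:R) by apply: expR_gt0.
case: (f2v_ratio t bu) => [->|[stp le1]|[g [bg gu Fg Hg]]]; first by left; rewrite mulr0.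
  right; exists [::], (wt (u, alpha)); split=> //; last by left; rewrite big_seq1.
  by rewrite -!mulrA ler_wpM2l ?expR_ge0 // ler_wpM2l ?expR_ge0.
have [|v0|[p [W [gp leW HW]]]] := IH t _ g beta bg; first by lia.
  (* Taking [c = 0] passes the vanishing of the message of [g] on to [u]. *)
  left; have := Hg 0; rewrite v0 mul0r lexx mul0r => /(_ isT) le0.
  suff -> : f2v (msg t.+1) beta u (~~ y u) = 0 by rewrite mulr0.
  by apply/eqP; rewrite eq_le le0; have [-> _] := msg_ge0 t.+1.
right; exists ((g, beta) :: p), (wt (u, alpha) + W); split.
- by rewrite /= gp andbT /step /= eqxx bg gu.
- by rewrite expRD -!mulrA ler_wpM2l ?expR_ge0 // mulrCA ler_wpM2l ?expR_ge0 ?Hg.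
case: HW => [[stp ->]|[leW' st]]; [left|right]; split=> //.
- by rewrite [RHS]big_cons.
- by rewrite big_cons -addrA lerD2l.
Qed.

(** The two outgoing messages of [u] together count its own weight twice, the belief only once. *)
Lemma belief_ratio t u alpha z : memF alpha u ->
  belief w t u z * expR (wp w u * (z : nat)%:R) =
  v2f (msg t.+1) u alpha z * v2f (msg t.+1) u (oth u alpha) z.
Proof.
move=> au; rewrite /belief (prod_both _ au) !v2f_succ ?oth_mem // oth_inv //; ring.
Qed.

Lemma belief_converges : exists T, forall t, (T <= t)%N -> forall u,
  belief w t u (~~ y u) < belief w t u (y u).
Proof.
have [b0 b0_ge0 b0P] := fin_ub (fun s => `|wt s|).
have [B [c [B0 c0 Bc]]] := path_weight_ub closed_walk_neg.
(* If one walk makes [n] steps without stopping, the exponent is at most [2 * B + 3 * b0 - c * n],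
   and [t <= 2 * n]. *)
pose T := Num.bound ((4 * B + 6 * b0) / c); exists T => t Tt u.
have cT : 4 * B + 6 * b0 < c * t%:R.
  have : 0 <= (4 * B + 6 * b0) / c by rewrite divr_ge0 ?(ltW c0) //; lra.
  move=> /archi_boundP; rewrite ltr_pdivrMr // [_ * c]mulrC => /lt_le_trans; apply.
  by rewrite ler_wpM2l ?(ltW c0) // ler_nat.
have [alpha [? [_ aP]]] := two_factors u.
have au : memF alpha u by rewrite aP eqxx.
have bu := oth_mem au; set beta := oth u alpha in bu.
have := belief_ratio t (~~ y u) au; have := belief_ratio t (y u) au; rewrite -/beta.
have [_ v_gt0] := msg_map_gt0 t.+1; have [_ v_ge0] := msg_ge0 t.+1.
set Y := belief _ _ _ (y u); set N := belief _ _ _ (~~ y u); clearbody Y N.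
have y1 := v_gt0 u alpha; have y2 := v_gt0 u beta.
have e0 : 0 < expR (wp w u * (y u : nat)%:R) by apply: expR_gt0.
have e1 : 0 < expR (wp w u * (~~ y u : nat)%:R) by apply: expR_gt0.
move=> YE NE.
have Y0 : 0 < Y by rewrite -(pmulr_lgt0 _ e0) YE mulr_gt0.
have [n1|[p1 [W1 [p1P le1 HW1]]]] := v2f_ratio b0P t.+1 au.
  by move: NE; rewrite n1 mul0r => /eqP; rewrite mulf_eq0 (gt_eqF e1) orbF => /eqP ->.
have [n2|[p2 [W2 [p2P le2 HW2]]]] := v2f_ratio b0P t.+1 bu.
  by move: NE; rewrite n2 mulr0 => /eqP; rewrite mulf_eq0 (gt_eqF e1) orbF => /eqP ->.
(* Both walks start at [u], so its weight is subtracted once. *)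
suff W_lt0 : W1 + W2 - wp w u * sgn u < 0.
  have : N * expR (wp w u * (~~ y u : nat)%:R) <=
         expR (W1 + W2) * (Y * expR (wp w u * (y u : nat)%:R)).
    by rewrite NE YE expRD [expR W1 * _ * _]mulrACA; apply: ler_pM => //; apply: v_ge0.
  rewrite expR_flip !mulrA ler_pM2r // -ler_pdivlMr ?expR_gt0 // mulrAC -expRN -expRD => leN.
  by apply: (le_lt_trans leN); rewrite gtr_pMl // expR_lt1.
have wu : `|wp w u * sgn u| <= b0 := b0P (u, alpha).
move: wu; rewrite ler_norml => /andP[wu1 wu2].
have ubW a p W : path step (u, a) p ->
    (stop (last (u, a) p) /\ W = \sum_(s <- (u, a) :: p) wt s) \/
    (W <= \sum_(s <- (u, a) :: p) wt s + b0 /\ (t.+1 <= (size p).*2.+1)%N) ->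
    W <= wp w u * sgn u + B + b0 - c * (size p)%:R.
  have -> : wp w u * sgn u = wt (u, a) by [].
  by move=> /Bc; rewrite !big_cons => le; case=> [[_ ->]|[leW _]]; lra.
have cs n : 0 <= c * n%:R by rewrite mulr_ge0 ?(ltW c0).
have st n : (t.+1 <= n.*2.+1)%N -> c * t%:R <= 2 * (c * n%:R).
  rewrite ltnS mulrCA => tn; apply: ler_wpM2l; first exact: ltW.
  apply: (@le_trans _ _ (n.*2)%:R); first by rewrite ler_nat.
  by rewrite -mul2n natrM.
have ub1 := ubW _ _ _ p1P HW1; have ub2 := ubW _ _ _ p2P HW2.
have c1 := cs (size p1); have c2 := cs (size p2).
(* A long walk loses by its length; two stopped walks are glued at [u]. *)
case: HW1 => [[s1 E1]|[_ /st l1]]; last by lra.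
case: HW2 => [[s2 E2]|[_ /st l2]]; last by lra.
rewrite E1 E2; exact: double_stop_neg.
Qed.

Lemma yBP_converges : exists T, forall t, (T <= t)%N -> forall u, yBP w t u = Some (y u).
Proof.
have [T HT] := belief_converges; exists T => t /HT H u; have := H u.
rewrite /yBP; case: (y u) => /= lt; rewrite lt //.
by rewrite ltNge (ltW lt).
Qed.

(** * Recovery of the maximum weight matching *)

Lemma xrec_max_matching : exists M : {set {set V}}, is_max_weight_matching E w M /\
  forall e, e \in E -> xrec R y e = (e \in M : nat)%:R.
Proof.
have Fy := map_feas Hcyc Hdisj ymap.
pose M := [set e in E | xrec R y e == 1]; exists M.
have xM e : e \in E -> xrec R y e = (e \in M : nat)%:R.
  move=> eE; rewrite inE eE /= xrecE.
  by have [->|->] := edge_val_feas Hcyc Hdisj Fy eE; rewrite ?eqxx // eq_sym oner_eq0.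
have deg1 i : (\sum_(e in E | i \in e) (e \in M : nat) <= 1)%N.
  have := Fy (inl i); rewrite feas_vertexE -!(ler_nat R) !natr_sum.
  rewrite -(edge_val_vertex Hcyc Hdisj (indic y)).
  suff -> : \sum_(e in E | i \in e) edge_val (indic y) e =
    \sum_(e in E | i \in e) (e \in M : nat)%:R by [].
  by apply: eq_bigr => e /andP[eE _]; rewrite -xM // xrecE.
have weight (M' : {set {set V}}) : M' \subset E ->
    \sum_(e in M') w e = CLP_obj E w (fun e => (e \in M' : nat)%:R).
  move=> /subsetP sub; rewrite /CLP_obj [RHS](bigID (mem M')) /= [X in _ = _ + X]big1.
    rewrite addr0; apply: eq_big => [e|e eM]; last by rewrite eM mulr1.
    by case eM: (e \in M'); rewrite ?andbF // sub.
  by move=> e /andP[_ /negPf ->]; rewrite mulr0.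
have objE (v : conf) (x : {set V} -> R) :
    (forall e, e \in E -> edge_val (indic v) e = x e) ->
    CLP_obj E w x = \sum_u wp w u * indic v u.
  move=> vx; rewrite -(edge_val_obj w Hcyc Hdisj).
  by apply: eq_bigr => e eE; rewrite vx.
split=> //; split.
  split=> [|e f eM fM ef]; first by apply/subsetP => e; rewrite inE => /andP[].
  apply/pred0P => i /=; apply/negP => /andP[ie jf].
  have eE : e \in E by move: eM; rewrite inE => /andP[].
  have fE : f \in E by move: fM; rewrite inE => /andP[].
  have := deg1 i; rewrite (bigD1 e) ?eE //= (bigD1 f) ?fE ?jf 1?eq_sym //=.
  by rewrite eM fM.
(* A competing matching lifts to an accepted assignment of the same weight, so [map_opt] applies. *)
move=> M' [sub dis].
have [i|v [Fv vx]] := @matching_lift R V K E cyc Hcyc Hdisj (fun e => e \in M').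
  apply: (@leq_trans #|[pred e | (i \in (e : {set V})) && (e \in M')]|).
    rewrite -sum1_card [leqLHS]big_mkcond [leqRHS]big_mkcond leq_sum // => e _ /=.
    by rewrite inE; case: (e \in E); case: (i \in e); case: (e \in M').
  apply/card_le1_eqP => e f; rewrite !inE => /andP[ie eM] /andP[jf fM].
  have [//|ef] := eqVneq f e; have /pred0P/(_ i) := dis _ _ fM eM ef.
  by rewrite /= ie jf.
rewrite !weight //; last by apply/subsetP => e; rewrite inE => /andP[].
rewrite (objE v) // (objE y) => [|e eE]; last by rewrite -xM // xrecE.
exact: map_opt.
Qed.

End BP.

Theorem theorem2 (R : realType) (V : finType) (E : {set {set V}}) (w : {set V} -> R)
  (K : finType) (cyc : K -> seq V)
  (HE : forall e, e \in E -> #|e| = 2%N)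
  (Hcyc : forall C, odd_cycle_of E (cyc C))
  (Hdisj : forall C D, C != D -> [disjoint ECset (cyc C) & ECset (cyc D)])
  (Hlp : CLP_unique_integral_opt E w cyc) :
  forall ystar : {ffun Ep E cyc -> bool}, is_MAP w ystar ->
    (exists T : nat, forall t, (T <= t)%N -> forall e, yBP w t e = Some (ystar e)) /\
    (exists M : {set {set V}}, is_max_weight_matching E w M /\
       forall e, e \in E -> xrec R ystar e = (e \in M : nat)%:R).
Proof.
move=> ystar ymap; split; first exact: yBP_converges.
exact: xrec_max_matching.
Qed.
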